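(* Let $0<p<q<\infty$ and let $E$ be a symmetric quasi-Banach function space on $\mathbb{R}_+$ with lower and upper Boyd indices $p_E$ and $q_E$. If $p<p_E\leq q_E<q$, then the linear operator $\Theta_{p,q}$, $\Theta_{p,q}f=f\otimes\theta_{p,q}$, is bounded from $E(\mathbb{R}_+)$ into $E(\mathbb{R}_+\times\mathbb{R}_+)$. Conversely, if $\Theta_{p,q}$ is bounded from $E(\mathbb{R}_+)$ into $E(\mathbb{R}_+\times\mathbb{R}_+)$, then $p\leq p_E\leq q_E\leq q$.
   Context: Let $\lambda$ be Lebesgue measure (on $\mathbb{R}_+$ or $\mathbb{R}_+\times\mathbb{R}_+$). For a measurable a.e. finite $f$, $d(v;f)=\lambda(|f|>v)$, $v\ge 0$. $S(\mathbb{R}_+)$ (resp. $S(\mathbb{R}_+\times\mathbb{R}_+)$) is the space of measurable a.e. finite functions $f$ with $d(v;f)<\infty$ for some $v>0$; for such $f$, $\mu_t(f)=\inf\{v>0: d(v;f)\le t\}$, $t\ge0$, is the decreasing rearrangement. A (nonzero) symmetric quasi-Banach function space $E$ on $\mathbb{R}_+$ is a complete quasi-normed linear subspace of $S(\mathbb{R}_+)$ such that if $f\in S(\mathbb{R}_+)$, $g\in E$ and $\mu(f)\le\mu(g)$ (in particular if $|f|\le |g|$), then $f\in E$ and $\|f\|_E\le\|g\|_E$. We write $E(\mathbb{R}_+)=E$ and $E(\mathbb{R}_+\times\mathbb{R}_+)=\{f\in S(\mathbb{R}_+\times\mathbb{R}_+):\mu(f)\in E\}$ with $\|f\|_{E(\mathbb{R}_+\times\mathbb{R}_+)}=\|\mu(f)\|_E$.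 Boyd indices: with $(D_af)(s)=f(as)$ (a bounded operator on $E$ with operator norm $\|D_a\|$ for each $0<a<\infty$), $$p_E=\lim_{s\to\infty}\frac{\log s}{\log\|D_{1/s}\|},\qquad q_E=\lim_{s\downarrow0}\frac{\log s}{\log\|D_{1/s}\|},$$ interpreted as $\infty$ if the denominator vanishes. Equivalently, $p_E=\sup\{p>0:\exists c>0\ \forall\, 0<a\le1,\ f\in E:\ \|D_af\|_E\le ca^{-1/p}\|f\|_E\}$ and $q_E=\inf\{q>0:\exists c>0\ \forall a\ge1,\ f\in E:\ \|D_af\|_E\le ca^{-1/q}\|f\|_E\}$ (with $\inf\emptyset=\infty$). For $0<p,q<\infty$, $\theta_{p,q}(t)=t^{-1/q}\chi_{(0,1)}(t)+t^{-1/p}\chi_{[1,\infty)}(t)$ for $t>0$, and $(f\otimes\theta_{p,q})(s,t)=f(s)\theta_{p,q}(t)$. *)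

(* Defs.v *)
From mathcomp Require Import all_boot all_order all_algebra.
From mathcomp Require Import all_classical all_reals all_analysis.

Set Implicit Arguments.
Unset Strict Implicit.
Unset Printing Implicit Defensive.

Import Order.TTheory GRing.Theory Num.Theory.
Import numFieldNormedType.Exports.

Local Open Scope classical_set_scope.
Local Open Scope ring_scope.

(* A function on a measurable subset D of T is represented by a total function
   T -> R whose values outside D are irrelevant.  Elements of S are a.e. finite,
   so they are represented by real-valued functions; two representatives of
   the same class have the same distribution function.                        *)
Section Rearrangement.
Context {d : measure_display} {T : measurableType d} {R : realType}.
Variables (m : {measure set T -> \bar R}) (D : set T).

Definition distribution_function (f : T -> R) (v : R) : \bar R :=
  m (D `&` [set x | v < `|f x|]).

Definition S_space : set (T -> R) :=
  [set f | measurable_fun D f /\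
           exists2 v : R, 0 < v & (distribution_function f v < +oo)%E].

(* For f in S_space this is finite at every t > 0, and possibly +oo at t = 0. *)
Definition rearrangement (f : T -> R) (t : R) : \bar R :=
  ereal_inf [set v%:E | v in
    [set v : R | 0 < v /\ (distribution_function f v <= t%:E)%E]].

End Rearrangement.

Section HalfLine.
Variable R : realType.

Definition Rplus : set R := `[0, +oo[.

Definition lebesgue2 := (@lebesgue_measure R \x @lebesgue_measure R)%E.

Definition S1 : set (R -> R) := S_space (@lebesgue_measure R) Rplus.
Definition mu1 : (R -> R) -> R -> \bar R :=
  rearrangement (@lebesgue_measure R) Rplus.

Definition S2 : set (R * R -> R) := S_space lebesgue2 (Rplus `*` Rplus).
Definition mu2 : (R * R -> R) -> R -> \bar R :=
  rearrangement lebesgue2 (Rplus `*` Rplus).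

(* The carrier is a set of functions rather than of classes; it is saturated for
   a.e. equality on Rplus, and the quasi-norm only depends on the class, by
   sqb_symmetric.                                                             *)
Record symmetric_quasi_Banach := SymmetricQuasiBanach {
  sqb_carrier : set (R -> R);
  sqb_norm : (R -> R) -> R;
  sqb_sub : sqb_carrier `<=` S1;
  sqb_zero : sqb_carrier (cst 0);
  sqb_add : forall f g, sqb_carrier f -> sqb_carrier g -> sqb_carrier (f \+ g);
  sqb_scale : forall (a : R) f, sqb_carrier f -> sqb_carrier (a \*o f);
  sqb_norm_ge0 : forall f, sqb_carrier f -> 0 <= sqb_norm f;
  sqb_norm_eq0 : forall f, sqb_carrier f ->
    (sqb_norm f = 0 <->
     {ae @lebesgue_measure R, forall x, Rplus x -> f x = 0});
  sqb_normZ : forall (a : R) f, sqb_carrier f ->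
    sqb_norm (a \*o f) = `|a| * sqb_norm f;
  sqb_normD : exists K : R, forall f g, sqb_carrier f -> sqb_carrier g ->
    sqb_norm (f \+ g) <= K * (sqb_norm f + sqb_norm g);
  sqb_complete : forall u : nat -> R -> R,
    (forall n, sqb_carrier (u n)) ->
    (forall e : R, 0 < e -> exists N : nat, forall i j : nat,
       (N <= i)%N -> (N <= j)%N -> sqb_norm (u i \- u j) < e) ->
    exists2 f, sqb_carrier f & sqb_norm (u n \- f) @[n --> \oo] --> (0 : R);
  sqb_symmetric : forall f g, S1 f -> sqb_carrier g ->
    (forall t, 0 <= t -> (mu1 f t <= mu1 g t)%E) ->
    sqb_carrier f /\ sqb_norm f <= sqb_norm g;
  sqb_nonzero : exists2 f, sqb_carrier f & sqb_norm f != 0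
}.

Definition dilation (a : R) (f : R -> R) : R -> R := fun s => f (a * s).

Section Space.
Variable E : symmetric_quasi_Banach.

(* [fine] only matters at t = 0, where the rearrangement may be infinite. *)
Definition E2 : set (R * R -> R) :=
  [set f | S2 f /\ sqb_carrier E (fun t => fine (mu2 f t))].
Definition E2_norm (f : R * R -> R) : R := sqb_norm E (fun t => fine (mu2 f t)).

(* The set is always bounded: every dilation is a bounded operator on E. *)
Definition dilation_norm (a : R) : R :=
  sup [set sqb_norm E (dilation a f) | f in
    [set f | sqb_carrier E f /\ sqb_norm E f <= 1]].

Definition boyd_quotient (s : R) : \bar R :=
  if ln (dilation_norm s^-1) == 0 then +oo%E
  else (ln s / ln (dilation_norm s^-1))%:E.

Definition lower_boyd : \bar R := lim (boyd_quotient s @[s --> +oo]).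
Definition upper_boyd : \bar R := lim (boyd_quotient s @[s --> 0^'+]).

Definition bounded_into_E2 (A : (R -> R) -> R * R -> R) : Prop :=
  (forall f, sqb_carrier E f -> E2 (A f)) /\
  exists C : R, forall f, sqb_carrier E f ->
    E2_norm (A f) <= C * sqb_norm E f.

End Space.

Definition theta (p q t : R) : R :=
  t `^ (- q^-1) * \1_(`]0, 1[%classic) t +
  t `^ (- p^-1) * \1_(`[1, +oo[%classic) t.

Definition Theta (p q : R) (f : R -> R) : R * R -> R :=
  fun st => f st.1 * theta p q st.2.

Lemma Theta_linear (p q a : R) (f g : R -> R) :
  Theta p q (a \*o f \+ g) = a \*o Theta p q f \+ Theta p q g.
Proof. by apply/funext => st; rewrite /Theta /= mulrDl mulrA. Qed.

End HalfLine.

(* Main.v *)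
Require Import Defs.
From mathcomp Require Import all_boot all_order all_algebra.
From mathcomp Require Import all_classical all_reals all_analysis.
From mathcomp Require Import measurable_realfun ring lra.

Import Order.TTheory GRing.Theory Num.Theory.
Import numFieldNormedType.Exports.

Local Open Scope classical_set_scope.
Local Open Scope ring_scope.

Set Implicit Arguments.
Unset Strict Implicit.
Unset Printing Implicit Defensive.

(* Every norm in sight depends only on distribution functions.

   Write N(a) for the norm of the dilation D_a on E.  It is finite, because the
   decreasing rearrangement can be cut into two scale-invariant pieces of density
   less than 1; it is submultiplicative and nonincreasing, so ln N(e^-x) is
   subadditive and Fekete's lemma yields both Boyd limits and p_E <= q_E.

   If p < p_E <= q_E < q, cut (0, oo) into geometric intervals I_n with ratio
   rho.  On I_n, f (x) theta is at most c^n |f|, which has the distribution of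
   c^n D_{1/|I_n|} f on the half-line.  Replacing 1/|I_n| by a slightly larger
   power w a^n, with sum_n w a^n |I_n| <= 1/2, still leaves c^n D_{w a^n} f with
   geometrically small norms, so some g in E dominates all of them and then
   d(v; f (x) theta) <= sum_n |I_n| w a^n d(v; g) <= d(v; g).

   Conversely, if theta >= c on a set of measure s, then c D_{1/s} f has a smaller
   distribution function than f (x) theta, whence N(1/s) <= C / c; the sets
   [s, 2s) and (0, s) give the bounds on p_E and q_E. *)

(** * Distribution functions and rearrangements *)

Section Rearrangement.
Context {d : measure_display} {T : measurableType d} {R : realType}.
Variables (m : {measure set T -> \bar R}) (D : set T).
Hypothesis mD : measurable D.
Implicit Types (f g : T -> R) (t v : R).

Local Notation dist := (distribution_function m D).

Lemma measurable_superlevel f v : measurable_fun D f ->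
  measurable (D `&` [set x | v < `|f x|]).
Proof.
move=> mf.
have mnf : measurable_fun D (fun x => `|f x|) by exact: measurableT_comp mf.
rewrite (_ : [set x | _] = (fun x => `|f x|) @^-1` `]v, +oo[).
  exact: mnf.
by apply/seteqP; split => x /=; rewrite in_itv/= andbT.
Qed.

Lemma distribution_function_ge0 f v : (0 <= dist f v)%E.
Proof. exact: measure_ge0. Qed.

Lemma distribution_function_dom f g v : measurable_fun D f ->
  measurable_fun D g -> (forall x, D x -> `|f x| <= `|g x|) ->
  (dist f v <= dist g v)%E.
Proof.
move=> mf mg fg; apply: le_measure; rewrite ?inE.
- exact: measurable_superlevel.
- exact: measurable_superlevel.
- by move=> x [Dx /= vf]; split => //=; exact: lt_le_trans (fg _ Dx).
Qed.

Lemma le_distribution_function f v w : measurable_fun D f -> v <= w ->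
  (dist f w <= dist f v)%E.
Proof.
move=> mf vw; apply: le_measure; rewrite ?inE; [exact: measurable_superlevel..|].
by move=> x [Dx /= wf]; split => //=; exact: le_lt_trans wf.
Qed.

(** Right continuity: the superlevel set at v is the increasing union of those at v + 1/(n+1), and
    measures are continuous from below. *)
Lemma distribution_function_rcont f v y : measurable_fun D f ->
  (forall w, v < w -> (dist f w <= y)%E) -> (dist f v <= y)%E.
Proof.
move=> mf h.
pose F n := D `&` [set x | v + n.+1%:R^-1 < `|f x|].
have UF : D `&` [set x | v < `|f x|] = \bigcup_n F n.
  apply/seteqP; split => [x [Dx /= vf]|x [n _ [Dx /= vf]]]; last first.
    by split => //=; apply: lt_trans vf; rewrite ltrDl invr_gt0.
  have [N hN] : exists N, N.+1%:R^-1 < `|f x| - v.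
    have fv : 0 < `|f x| - v by rewrite subr_gt0.
    exists (Num.truncn (`|f x| - v)^-1).
    rewrite invf_plt ?posrE ?invr_gt0//.
    by rewrite truncnS_gt.
  by exists N => //; split => //=; rewrite -ltrBrDl.
rewrite /distribution_function UF.
have mF n : measurable (F n) by exact: measurable_superlevel.
have ndF : nondecreasing_seq F.
  move=> i j ij; apply/subsetPset => x [Dx /= vf]; split => //=.
  apply: le_lt_trans vf; rewrite lerD2l lef_pV2 ?posrE//.
  by rewrite ler_nat.
have c : m (F n) @[n --> \oo] --> m (\bigcup_n F n).
  by apply: nondecreasing_cvg_mu => //; exact: bigcupT_measurable.
apply: (cvge_to_le c); apply: nearW => n; apply: h.
by rewrite ltrDl invr_gt0.
Qed.

(** The Galois connection that turns every statement on rearrangements into one on distribution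
    functions. Right continuity makes it hold at the infimum itself, and also at v = 0. *)
Lemma rearrangement_le f v t : measurable_fun D f -> 0 <= v ->
  (rearrangement m D f t <= v%:E)%E = (dist f v <= t%:E)%E.
Proof.
move=> mf v0; apply/idP/idP => [h|h].
  apply: distribution_function_rcont => // w vw.
  have : (rearrangement m D f t < w%:E)%E by rewrite (le_lt_trans h)// lte_fin.
  move=> /ereal_inf_lt[_ [u [u0 fu] <-]]; rewrite lte_fin => uw.
  by apply: le_trans fu; apply: le_distribution_function => //; exact: ltW.
apply/lee_addgt0Pr => e e0; apply: ereal_inf_lbound.
exists (v + e) => //; split; first by rewrite ltr_wpDl.
by apply: le_trans h; apply: le_distribution_function => //; rewrite lerDl ltW.
Qed.

Lemma rearrangement_ge0 f t : (0 <= rearrangement m D f t)%E.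
Proof. by apply: le_ereal_inf_tmp => _ [v [v0 _] <-]; rewrite lee_fin ltW. Qed.

(** Continuity from above along the levels v0 + n: f is real-valued, so these superlevel sets have
    empty intersection, and membership in S makes the first of them of finite measure. *)
Lemma distribution_function_cvg0 f t : S_space m D f -> 0 < t ->
  exists2 v, 0 < v & (dist f v <= t%:E)%E.
Proof.
move=> [mf [v0 v00 fin]] t0.
pose F n := D `&` [set x | v0 + n%:R < `|f x|].
have mF n : measurable (F n) by exact: measurable_superlevel.
have IF : \bigcap_n F n = set0.
  rewrite -subset0 => x /= h.
  have [_ /=] := h (Num.truncn `|f x|).+1 I.
  apply/negP; rewrite -leNgt; apply: le_trans (ltW (truncnS_gt _)) _.
  by rewrite lerDr ltW.
have niF : nonincreasing_seq F.
  move=> i j ij; apply/subsetPset => x [Dx /= vf]; split => //=.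
  by apply: le_lt_trans vf; rewrite lerD2l ler_nat.
have F0 : (m (F 0%N) < +oo)%E by rewrite /F addr0.
have c : m (F n) @[n --> \oo] --> 0%E.
  rewrite -(measure0 m) -IF.
  by apply: nonincreasing_cvg_mu => //; exact: bigcapT_measurable.
have [n hn] : exists n, (m (F n) < t%:E)%E.
  apply: contrapT => /forallNP hF.
  have : (t%:E <= 0)%E.
    by apply: (cvge_ge _ c); apply: nearW => n; rewrite leNgt; exact/negP.
  by rewrite lee_fin leNgt t0.
exists (v0 + n%:R); [by rewrite ltr_wpDr|exact: ltW].
Qed.

Lemma rearrangement_fin_num f t : S_space m D f -> 0 < t ->
  rearrangement m D f t \is a fin_num.
Proof.
move=> Sf t0; have [v v0 fv] := distribution_function_cvg0 Sf t0.
rewrite ge0_fin_numE ?rearrangement_ge0//.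
apply: (@le_lt_trans _ _ v%:E); last by rewrite ltry.
by rewrite rearrangement_le ?(ltW v0)//; exact: Sf.1.
Qed.

End Rearrangement.

(** * Scaling and equimeasurability on the half-line *)

Section HalfLine.
Variable R : realType.
Implicit Types (f g : R -> R) (a v : R).

Local Notation lambda := (@lebesgue_measure R).
Local Notation dist := (distribution_function lambda (@Rplus R)).

Lemma measurable_Rplus : measurable (@Rplus R).
Proof. exact: measurable_itv. Qed.
#[local] Hint Extern 0 (measurable (Rplus (R:=_))) =>
  solve [exact: measurable_Rplus] : core.

(** By uniqueness of Lebesgue measure: a times the image measure under x -> a x has the right value
    on every half-open interval. *)
Lemma lebesgue_measure_dilation a (A : set R) : 0 < a -> measurable A ->
  lambda ((fun x => a * x) @^-1` A) = (a^-1%:E * lambda A)%E.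
Proof.
move=> a0 mA.
pose na := NngNum (ltW a0).
pose phi : measurableTypeR R -> measurableTypeR R := *%R a.
have mphi : measurable_fun setT phi by exact: mulrl_measurable.
suff E : lambda A = (a%:E * pushforward lambda phi A)%E.
  by rewrite E muleA -EFinM mulVf ?gt_eqF// mul1e.
have uniq := @lebesgue_measure_unique R (mscale na (pushforward lambda phi)).
apply: (uniq mphi) => // _ [[x y]] _ <-.
rewrite /= /mscale /= /pushforward.
rewrite (_ : _ @^-1` _ = `]x / a, y / a]%classic); last first.
  apply/seteqP; split => z /=; rewrite !in_itv/= ltr_pdivrMr// ler_pdivlMr//.
    by rewrite mulrC.
  by rewrite mulrC.
rewrite !lebesgue_measure_itv/= !lte_fin ltr_pM2r ?invr_gt0//.
case: ifPn => _; last by rewrite mule0.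
by rewrite -EFinD -EFinM -mulrBl mulrCA divff ?gt_eqF// mulr1.
Qed.

Lemma measurable_dilation a f : 0 <= a ->
  measurable_fun (@Rplus R) f -> measurable_fun (@Rplus R) (dilation a f).
Proof.
move=> a0 mf; apply: (measurable_comp (F := @Rplus R)) => //.
  move=> _ [x + <-]; rewrite /Rplus/= !in_itv/= !andbT => x0.
  exact: mulr_ge0.
Qed.

Lemma distribution_function_dilation a f v : 0 < a ->
  measurable_fun (@Rplus R) f ->
  dist (dilation a f) v = (a^-1%:E * dist f v)%E.
Proof.
move=> a0 mf; rewrite -lebesgue_measure_dilation//; last first.
  exact: measurable_superlevel.
congr (lambda _); apply/seteqP; split => x [].
  rewrite /Rplus/= !in_itv/= !andbT => x0 vx; split => //.
  by rewrite mulr_ge0// ltW.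
rewrite /Rplus/= !in_itv/= !andbT => x0 vx; split => //.
by rewrite -(pmulr_rge0 _ a0).
Qed.

Section Transfer.
Context {d : measure_display} {T : measurableType d}.
Variables (m : {measure set T -> \bar R}) (D : set T).
Hypothesis mD : measurable D.
Variable (F : T -> R).
Hypothesis SF : S_space m D F.

Local Notation F' := (fun t => fine (rearrangement m D F t)).

(** On t > 0 the function is finite and nonincreasing, so its superlevel sets are intervals. The
    point 0 is split off first, because [fine] breaks monotonicity there when the rearrangement is
    infinite. *)
Lemma measurable_rearrangement : measurable_fun (@Rplus R) F'.
Proof.
apply/measurable_fun_itv_obnd_cbndP.
apply: (measurability (@RGenCInfty.G R)) => [|/= _ [_] [r] -> <-].
  exact: RGenCInfty.measurableE.
apply: is_interval_measurable => s t/=; rewrite !in_itv/= !andbT.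
move=> [s0 rs] [t0 rt] u /andP[su ut].
have u0 : 0 < u by exact: lt_le_trans su.
rewrite !in_itv/= !andbT; split => //; apply: (le_trans rt).
apply: fine_le; [exact: rearrangement_fin_num..|].
apply: ereal_inf_le_tmp => _ [v [v0 vu] <-]; exists v => //; split => //.
by rewrite (le_trans vu)// lee_fin.
Qed.

Lemma rearrangement_gt t v : 0 < t -> 0 <= v ->
  (v < `|F' t|) = (t%:E < distribution_function m D F v)%E.
Proof.
move=> t0 v0; rewrite ger0_norm; last first.
  by rewrite fine_ge0// rearrangement_ge0.
rewrite !ltNge; congr (~~ _); rewrite -lee_fin fineK ?rearrangement_fin_num//.
by rewrite rearrangement_le//; case: SF.
Qed.

(** With c = d(v; F), the superlevel set of [F'] lies between ]0, c[ and [0, c], whatever value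
    [fine] gives at 0; so F and its rearrangement are equimeasurable. *)
Lemma distribution_function_rearrangement v : 0 <= v ->
  dist F' v = distribution_function m D F v.
Proof.
move=> v0.
have mS : measurable (@Rplus R `&` [set x | v < `|F' x|]).
  by apply: measurable_superlevel => //; exact: measurable_rearrangement.
have := distribution_function_ge0 m D F v.
case E : (distribution_function m D F v) => [c| |] // c0.
- rewrite lee_fin in c0; apply/eqP; rewrite eq_le; apply/andP; split.
    have -> : c%:E = lambda `[0, c]%classic.
      rewrite lebesgue_measure_itv/= lte_fin sube0; case: ltP => //= c0'.
      by congr (_%:E); apply/eqP; rewrite eq_le c0 c0'.
    apply: le_measure; rewrite ?inE// => x [].
    rewrite /Rplus/= !in_itv/= andbT le_eqVlt => /predU1P[<- _|x0].
      by rewrite eqxx.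
    by rewrite rearrangement_gt// E lte_fin x0 orbT => /ltW ->.
  have -> : c%:E = lambda `]0, c[%classic.
    rewrite lebesgue_measure_itv/= lte_fin sube0; case: ltP => //= c0'.
    by congr (_%:E); apply/eqP; rewrite eq_le c0 c0'.
  apply: le_measure; rewrite ?inE// => x.
  rewrite /Rplus/= !in_itv/= andbT => /andP[x0 xc]; split; first exact: ltW.
  by rewrite rearrangement_gt// E lte_fin.
- apply/eqP; rewrite -leye_eq.
  have <- : lambda `]0, +oo[%classic = +oo%E.
    by rewrite lebesgue_measure_itv/= ltry.
  apply: le_measure; rewrite ?inE// => x.
  rewrite /Rplus/= !in_itv/= !andbT => x0; split; first exact: ltW.
  by rewrite rearrangement_gt// E ltry.
Qed.

End Transfer.

Lemma ae_distribution_function_dom f g v : measurable_fun (@Rplus R) f ->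
  measurable_fun (@Rplus R) g ->
  {ae lambda, forall x, Rplus x -> `|f x| <= `|g x|} ->
  (dist f v <= dist g v)%E.
Proof.
move=> mf mg [N [mN N0 fgN]].
rewrite -[leRHS]adde0 -N0.
apply: (@le_trans _ _ (lambda ((@Rplus R `&` [set x | v < `|g x|]) `|` N))).
  apply: le_measure; rewrite ?inE.
  - exact: measurable_superlevel.
  - by apply: measurableU => //; exact: measurable_superlevel.
  move=> x [x0 /= vf]; have [fg|fg] := leP `|f x| `|g x|.
    by left; split => //=; exact: lt_le_trans fg.
  by right; apply: fgN => /= /(_ x0); apply/negP; rewrite -ltNge.
by apply: measureU2 => //; exact: measurable_superlevel.
Qed.

End HalfLine.
#[global] Hint Extern 0 (measurable (Rplus (R:=_))) =>
  solve [exact: measurable_Rplus] : core.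

(** * Boundedness of dilations *)

Section SymmetricSpace.
Variables (R : realType) (E : symmetric_quasi_Banach R).
Implicit Types (f g : R -> R) (a v : R).

Local Notation lambda := (@lebesgue_measure R).
Local Notation dist := (distribution_function lambda (@Rplus R)).
Local Notation car := (sqb_carrier E).
Local Notation nrm := (sqb_norm E).

Lemma sqb_measurable f : car f -> measurable_fun (@Rplus R) f.
Proof. by move=> /(@sqb_sub _ E)[]. Qed.

(** The form in which the symmetry axiom is applied below. Levels v > 0 suffice, since the infimum
    defining the rearrangement ranges over these only. *)
Lemma sqb_distribution f g : measurable_fun (@Rplus R) f -> car g ->
  (forall v, 0 < v -> (dist f v <= dist g v)%E) ->
  car f /\ nrm f <= nrm g.
Proof.
move=> mf Eg fg; apply: sqb_symmetric => //.
  split => //; have [_ [v v0 gv]] := sqb_sub Eg; exists v => //.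
  exact: le_lt_trans (fg _ v0) gv.
move=> t t0; apply: ereal_inf_le_tmp => _ [v [v0 gv] <-].
by exists v => //; split => //; exact: le_trans (fg _ v0) gv.
Qed.

Lemma sqb_ae_dom f g : measurable_fun (@Rplus R) f -> car g ->
  {ae lambda, forall x, Rplus x -> `|f x| <= `|g x|} ->
  car f /\ nrm f <= nrm g.
Proof.
move=> mf Eg fg; apply: sqb_distribution => // v _.
by apply: ae_distribution_function_dom => //; exact: sqb_measurable.
Qed.

Lemma sqb_dom f g : measurable_fun (@Rplus R) f -> car g ->
  (forall x, Rplus x -> `|f x| <= `|g x|) -> car f /\ nrm f <= nrm g.
Proof. by move=> mf Eg fg; apply: sqb_ae_dom => //; exact: aeW. Qed.

(** Normalising the constant to K >= 1 keeps the ratio 1/(2K) used for series at most 1/2. *)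
Lemma sqb_quasi : exists2 K : R, 1 <= K & forall f g, car f -> car g ->
  nrm (f \+ g) <= K * (nrm f + nrm g).
Proof.
have [K hK] := sqb_normD E; exists (Num.max 1 K); first by rewrite le_max lexx.
move=> f g Ef Eg; apply: (le_trans (hK _ _ Ef Eg)).
apply: ler_wpM2r; last by rewrite le_max lexx orbT.
by rewrite addr_ge0//; exact: sqb_norm_ge0.
Qed.

(** For F on the quarter-plane this is membership in [E2] with a norm bound, obtained from a
    comparison with a function on the half-line. *)
Lemma sqb_rearrangement {d} {T : measurableType d}
    (m : {measure set T -> \bar R}) (D : set T) (F : T -> R) g :
  measurable D -> measurable_fun D F -> car g ->
  (forall v, 0 < v -> (distribution_function m D F v <= dist g v)%E) ->
  [/\ S_space m D F, car (fun t => fine (rearrangement m D F t)) &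
    nrm (fun t => fine (rearrangement m D F t)) <= nrm g].
Proof.
move=> mD mF Eg Fg.
have SF : S_space m D F.
  split => //; have [_ [v v0 gv]] := sqb_sub Eg; exists v => //.
  exact: le_lt_trans (Fg _ v0) gv.
have [|//|v v0|] := @sqb_distribution (fun t => fine (rearrangement m D F t)) g.
- exact: measurable_rearrangement.
- by rewrite distribution_function_rearrangement ?Fg// ltW.
- by split.
Qed.

(** The opposite transfer, from [E2] back to E; it serves the necessity of the index bounds. *)
Lemma rearrangement_sqb {d} {T : measurableType d}
    (m : {measure set T -> \bar R}) (D : set T) (F : T -> R) f :
  measurable D -> S_space m D F ->
  car (fun t => fine (rearrangement m D F t)) ->
  measurable_fun (@Rplus R) f ->
  (forall v, 0 < v -> (dist f v <= distribution_function m D F v)%E) ->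
  car f /\ nrm f <= nrm (fun t => fine (rearrangement m D F t)).
Proof.
move=> mD SF EF mf fF; apply: sqb_distribution => // v v0.
by rewrite distribution_function_rearrangement ?fF// ltW.
Qed.

(* Cutting D_rho f* (f* the decreasing rearrangement) along A gives two functions
   whose distributions are at most that of f, so D_rho is bounded. *)
Lemma interleaving_set : exists A : set R, exists2 rho : R,
  measurable A /\ 0 < rho < 1 &
  forall c, 0 <= c ->
    (lambda (`[0%R, c] `&` A) <= (rho * c)%:E)%E /\
    (lambda (`[0%R, c] `&` ~` A) <= (rho * c)%:E)%E.
Proof.
pose fl (t : R) : R := (Num.floor (ln t / 2))%:~R.
(* For t > 0, membership means that ln t lies in [2m, 2m+1) for some integer m: every second shell
   of ratio e, a pattern invariant under scaling by e^2. *)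
pose A := [set t : R | ln t - 2 * fl t < 1].
have mln : measurable_fun [set: R] (fun t : R => ln t / 2).
  by apply: measurable_funM.
have mfl : measurable_fun setT fl.
  have mfloor : measurable_fun setT (fun z : R => (Num.floor z)%:~R : R).
    apply: nondecreasing_measurable => // x y xy.
    by rewrite ler_int; exact: le_floor.
  exact: measurableT_comp mfloor mln.
have mA : measurable A.
  rewrite (_ : A = setT `&` (fun t => ln t - 2 * fl t) @^-1` `]-oo, 1[).
    have : measurable_fun setT (fun t => ln t - 2 * fl t).
      apply: measurable_funB; first exact: measurable_ln.
      by apply: measurable_funM.
    by apply.
  by rewrite setTI; apply/seteqP; split => t /=; rewrite in_itv.
(* A set that misses [x, y) loses at least the length y - x from [0, c]. *)
have gap (B : set R) c x y : measurable B -> 0 <= x -> x <= y -> y <= c ->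
    (forall t, x <= t < y -> ~ B t) ->
    (lambda (`[0%R, c] `&` B) <= (c - (y - x))%:E)%E.
  move=> mB x0 xy yc hB.
  apply: (@le_trans _ _ (lambda (`[0%R, x]%classic `|` `[y, c]%classic))).
    apply: le_measure; rewrite ?inE; [exact: measurableI|exact: measurableU|].
    move=> t [/=]; rewrite !in_itv/= => /andP[t0 tc] Bt.
    have [tx|xt] := leP t x; first by left; rewrite t0.
    have [yt|ty] := leP y t; first by right; rewrite tc.
    by exfalso; apply: (hB t) => //; rewrite ty (ltW xt).
  apply: (le_trans (measureU2 _ _ _)) => //.
  have len (s t : R) : s <= t -> lambda `[s, t]%classic = (t - s)%:E.
    move=> st; rewrite lebesgue_measure_itv/= lte_fin.
    move: st; rewrite le_eqVlt => /predU1P[->|->//].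
    by rewrite ltxx subrr.
  by rewrite /= !len// subr0 -EFinD lee_fin; lra.
have e1 : 2 <= expR 1 :> R by have := expR_ge1Dx (1 : R); lra.
(* If 2m <= ln c < 2m + 2, both [A] and its complement miss a shell inside [0, c] of length at least
   e^(2m-2), which exceeds c e^(-4). *)
exists A, (1 - expR (- 4)).
  split => //; have := expR_gt0 (- 4 : R).
  have : expR (- 4) < 1 :> R by rewrite expR_lt1; lra.
  by move=> *; lra.
move=> c; rewrite le_eqVlt => /predU1P[<-|c0].
  rewrite mulr0; split; rewrite -[leRHS](lebesgue_measure_set1 0);
    by apply: le_measure; rewrite ?inE//;
      [apply: measurableI => //; exact: measurableC|rewrite set_itv1 => ? []].
pose m : R := fl c.
have [m1 m2] : 2 * m <= ln c /\ ln c < 2 * m + 2.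
  rewrite /m /fl; split.
    by have := floor_le (ln c / 2); lra.
  by have := floorD1_gt (ln c / 2); rewrite intrD1; lra.
have expln (t x : R) : 0 < t -> (expR x <= t) = (x <= ln t).
  by move=> t0; rewrite -{1}(lnK t0) ler_expR.
have explnlt (t x : R) : 0 < t -> (t < expR x) = (ln t < x).
  by move=> t0; rewrite -{1}(lnK t0) ltr_expR.
have flE t : 2 * m - 2 <= ln t < 2 * m -> fl t = m - 1.
  move=> /andP[h1 h2]; rewrite /fl (@floor_def _ _ (Num.floor (ln c / 2) - 1)).
    by rewrite intrB.
  by rewrite subrK intrB -/(fl c) -/m /=; apply/andP; split; lra.
have cE : c * expR (- 4) <= expR (2 * m - 2).
  rewrite -{1}(lnK c0) -expRD ler_expR; lra.
have step (x : R) : expR (2 * m - 2) <= x -> expR (2 * m - 2) <= x * expR 1 - x.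
  have := expR_gt0 (2 * m - 2); nra.
have le12 : expR (2 * m - 2) <= expR (2 * m - 1) by rewrite ler_expR; lra.
have le23 : expR (2 * m - 1) <= expR (2 * m) by rewrite ler_expR; lra.
have le3c : expR (2 * m) <= c by rewrite expln.
split.
  (* [A] misses the shell 2m-1 <= ln t < 2m; its length is at least its left endpoint because e >=
     2. *)
  apply: (le_trans (gap A c (expR (2 * m - 1)) (expR (2 * m)) _ _ _ _ _)) => //.
  - move=> t /andP[h1 h2] /=; have t0 := lt_le_trans (expR_gt0 _) h1.
    move: h1 h2; rewrite expln// explnlt// => h1 h2.
    by rewrite /A/= flE; [apply/negP; rewrite -leNgt; lra|apply/andP; split; lra].
  have -> : expR (2 * m) = expR (2 * m - 1) * expR 1.
    by rewrite -expRD; congr expR; lra.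
  by rewrite lee_fin; have := step _ le12; lra.
(* The complement misses the preceding shell 2m-2 <= ln t < 2m-1. *)
apply: (le_trans
  (gap (~` A) c (expR (2 * m - 2)) (expR (2 * m - 1)) _ _ _ _ _)) => //.
- exact: measurableC.
- exact: le_trans le3c.
- move=> t /andP[h1 h2] /=; have t0 := lt_le_trans (expR_gt0 _) h1.
  move: h1 h2; rewrite expln// explnlt// => h1 h2.
  by apply; rewrite /A/= flE; [lra|apply/andP; split; lra].
have -> : expR (2 * m - 1) = expR (2 * m - 2) * expR 1.
  by rewrite -expRD; congr expR; lra.
by rewrite lee_fin; have := step _ (lexx _); lra.
Qed.

Let bounded_dilation a := exists2 C, 0 <= C & forall f, car f ->
  car (dilation a f) /\ nrm (dilation a f) <= C * nrm f.

Lemma sqb_dilation_ge1 a f : 1 <= a -> car f ->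
  car (dilation a f) /\ nrm (dilation a f) <= nrm f.
Proof.
move=> a1 Ef; have a0 : 0 < a by exact: lt_le_trans a1.
have mf := sqb_measurable Ef.
apply: sqb_distribution => //; first exact: measurable_dilation (ltW a0) mf.
move=> v v0; rewrite distribution_function_dilation//.
rewrite -[leRHS]mul1e lee_wpmul2r ?distribution_function_ge0//.
by rewrite lee_fin invf_le1.
Qed.

Let bounded_dilation_ge1 a : 1 <= a -> bounded_dilation a.
Proof.
by move=> a1; exists 1 => // f Ef; rewrite mul1r; exact: sqb_dilation_ge1.
Qed.

Lemma dilationM a b f : dilation a (dilation b f) = dilation (a * b) f.
Proof. by apply/funext => s; rewrite /dilation mulrCA mulrA. Qed.

Let bounded_dilationM a b :
  bounded_dilation a -> bounded_dilation b -> bounded_dilation (a * b).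
Proof.
move=> [C C0 hC] [C' C'0 hC']; exists (C * C'); first exact: mulr_ge0.
move=> f Ef; rewrite -dilationM.
have [Ebf bf] := hC' f Ef; have [Eabf abf] := hC _ Ebf.
by split => //; apply: (le_trans abf); rewrite -mulrA ler_wpM2l.
Qed.

Let bounded_dilation_lt1 : exists2 rho : R, 0 < rho < 1 & bounded_dilation rho.
Proof.
have [A [rho [mA /andP[rho0 rho1]] hA]] := interleaving_set.
exists rho; first by rewrite rho0.
have [K K1 hK] := sqb_quasi.
exists (2 * K) => [|f Ef]; first by lra.
have mf := sqb_measurable Ef.
have Sf := sqb_sub Ef.
pose h t := fine (mu1 f t).
have mh : measurable_fun (@Rplus R) h.
  by apply: (measurable_rearrangement _ Sf); exact: measurable_Rplus.
have mDh : measurable_fun (@Rplus R) (dilation rho h).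
  by apply: measurable_dilation => //; exact: ltW.
pose hB (B : set R) x := dilation rho h x * \1_B x.
have mhB B : measurable B -> measurable_fun (@Rplus R) (hB B).
  by move=> mB; apply: measurable_funM => //; exact: measurable_indic.
(* With c = d(v; f), the set where D_rho h exceeds v lies in [0, c/rho] since h is nonincreasing;
   its part in B has measure at most rho (c/rho) = c. *)
have half (B : set R) : measurable B ->
    (forall c, 0 <= c -> (lambda (`[0%R, c] `&` B) <= (rho * c)%:E)%E) ->
    car (hB B) /\ nrm (hB B) <= nrm f.
  move=> mB hc; apply: sqb_distribution => //; first exact: mhB.
  move=> v v0; have := distribution_function_ge0 lambda (@Rplus R) f v.
  case fv : (dist f v) => [c| |] // c0; last by rewrite leey.
  rewrite lee_fin in c0.
  have c1 : 0 <= c / rho by rewrite divr_ge0// ltW.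
  have -> : c = rho * (c / rho) by rewrite mulrC divfK// gt_eqF.
  apply: (@le_trans _ _ (lambda (`[0%R, c / rho] `&` B))); last exact: hc.
  apply: le_measure; rewrite ?inE.
  - by apply: measurable_superlevel => //; exact: mhB.
  - exact: measurableI.
  move=> x; rewrite /hB /Rplus/= in_itv/= andbT indicE => -[x0].
  case: (asboolP (B x)) => Bx; last first.
    by rewrite memNset// mulr0 normr0 ltNge (ltW v0).
  rewrite mem_set// mulr1 => vx; split => //; rewrite in_itv/= x0/=.
  move: x0; rewrite le_eqVlt => /predU1P[<-//|x0].
  rewrite ler_pdivlMr// mulrC.
  move: vx; rewrite /dilation /h rearrangement_gt ?mulr_gt0 ?(ltW v0)//.
  by rewrite -/(dist f v) fv lte_fin => /ltW.
have [E1 n1] := half A mA (fun c c0 => (hA c c0).1).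
have [E2 n2] := half (~` A) (measurableC mA) (fun c c0 => (hA c c0).2).
(* The two pieces add up to D_rho h, which is equimeasurable with D_rho f because h is with f. *)
have [//||v v0|EDf nDf] :=
    @sqb_distribution (dilation rho f) (hB A \+ hB (~` A)).
- by apply: measurable_dilation => //; exact: ltW.
- exact: sqb_add.
- rewrite (_ : hB A \+ hB (~` A) = dilation rho h); last first.
    apply/funext => x; rewrite /hB /= -mulrDr !indicE in_setC.
    by case: (x \in A); rewrite /= ?addr0 ?add0r mulr1.
  rewrite !distribution_function_dilation// /h.
  by rewrite distribution_function_rearrangement// ltW.
split => //; apply: (le_trans nDf); apply: (le_trans (hK _ _ E1 E2)).
by rewrite (mulrC 2) -mulrA; apply: ler_wpM2l; lra.
Qed.

(** Factor a as (a / rho^n) rho^n with n so large that the first factor is at least 1, where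
    dilations are contractive. *)
Lemma sqb_dilation a : 0 < a -> exists2 C, 0 <= C & forall f, car f ->
  car (dilation a f) /\ nrm (dilation a f) <= C * nrm f.
Proof.
move=> a0; have [rho /andP[rho0 rho1] hrho] := bounded_dilation_lt1.
have [n hn] : exists n, rho ^+ n < a.
  have rn : rho ^+ n @[n --> \oo] --> 0.
    by apply: cvg_expr; rewrite gtr0_norm.
  have /cvgr0Pnorm_lt /(_ a a0)[N _ /(_ N (leqnn N))] := rn.
  by rewrite /= gtr0_norm ?exprn_gt0//; exists N.
rewrite -/(bounded_dilation a).
have -> : a = a / rho ^+ n * rho ^+ n by rewrite divfK ?gt_eqF ?exprn_gt0.
apply: bounded_dilationM.
  by apply: bounded_dilation_ge1; rewrite ler_pdivlMr ?exprn_gt0// mul1r ltW.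
elim: n {hn} => [|n IH]; first by rewrite expr0; exact: bounded_dilation_ge1.
by rewrite exprS; exact: bounded_dilationM.
Qed.

End SymmetricSpace.

(** * Subadditive functions and the Boyd indices *)

(** A description of limits by order alone, which treats finite and infinite limits alike; the Boyd
    indices may be infinite. *)
Lemma cvge_orderP (R : realType) (T : Type) (F : set_system T) (FF : Filter F)
    (Q : T -> \bar R) (L : \bar R) :
  (forall r : R, (r%:E < L)%E -> \forall x \near F, (r%:E < Q x)%E) ->
  (forall r : R, (L < r%:E)%E -> \forall x \near F, (Q x < r%:E)%E) ->
  Q @ F --> L.
Proof.
case: L => [l| |] lQ Ql.
- move=> A /= [e /= e0 hA].
  have le : ((l - e)%:E < l%:E)%E by rewrite lte_fin; lra.
  have el : (l%:E < (l + e)%:E)%E by rewrite lte_fin; lra.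
  apply: filterS2 (lQ _ le) (Ql _ el) => x h1 h2.
  change (A (Q x)).
  move: h1 h2; case: (Q x) => // r.
  rewrite !lte_fin => h1 h2; apply: hA => /=.
  by rewrite ltr_distlC; apply/andP; split; lra.
- by apply/cvgeyPgt => A; apply: lQ; rewrite ltry.
- by apply/cvgeNyPlt => A; apply: Ql; rewrite ltNyr.
Unshelve. all: by end_near. Qed.

Section Subadditive.
Variables (R : realType) (phi : R -> R).
Implicit Types x r : R.
Hypothesis phiD : forall x y, phi (x + y) <= phi x + phi y.
Hypothesis phi_nd : {homo phi : x y / x <= y}.
Hypothesis phi0 : phi 0 = 0.

(** For phi x = ln N(e^(-x)) this is the Boyd quotient at s = e^x, with the same convention for a
    vanishing denominator. *)
Let Q x : \bar R := if phi x == 0 then +oo%E else (x / phi x)%:E.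

Lemma subadditive_natmul n x : phi (n%:R * x) <= n%:R * phi x.
Proof.
elim: n => [|n IH]; first by rewrite !mul0r phi0.
rewrite -natr1 !mulrDl !mul1r; apply: (le_trans (phiD _ _)).
by rewrite lerD2r.
Qed.

Lemma subadditive_ge0 x : 0 <= x -> 0 <= phi x.
Proof. by move=> x0; rewrite -phi0; exact: phi_nd. Qed.

Lemma subadditive_oppr x : - phi (- x) <= phi x.
Proof. by rewrite lerNl -subr_ge0 opprK addrC -phi0 -(subrr x). Qed.

(** Round x up to a multiple (n+1) x0 with n <= x/x0; monotonicity and subadditivity do the rest. *)
Lemma subadditive_le x0 x : 0 < x0 -> 0 <= x ->
  phi x <= (x / x0 + 1) * phi x0.
Proof.
move=> x0_gt0 x_ge0.
have t0 : 0 <= x / x0 by rewrite divr_ge0// ltW.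
have /andP[n1 n2] := truncn_itv t0.
set n := Num.truncn _ in n1 n2.
apply: (@le_trans _ _ (phi (n.+1%:R * x0))).
  by apply: phi_nd; rewrite -ler_pdivrMr// ltW.
apply: (le_trans (subadditive_natmul _ _)).
apply: ler_wpM2r; first by apply: subadditive_ge0; exact: ltW.
by rewrite -natr1 lerD2r.
Qed.

(** The mirror estimate: round x down to n x0 with n > x/x0 - 1. *)
Lemma subadditive_oppr_ge x0 x : 0 < x0 -> 0 <= x ->
  (x / x0 - 1) * - phi (- x0) <= - phi (- x).
Proof.
move=> x0_gt0 x_ge0.
have t0 : 0 <= x / x0 by rewrite divr_ge0// ltW.
have /andP[n1 n2] := truncn_itv t0.
set n := Num.truncn _ in n1 n2.
have p0 : 0 <= - phi (- x0).
  by rewrite oppr_ge0 -phi0; apply: phi_nd; rewrite oppr_le0 ltW.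
apply: (@le_trans _ _ (n%:R * - phi (- x0))).
  by apply: ler_wpM2r => //; rewrite lerBlDr natr1 ltW.
rewrite mulrN lerN2; apply: le_trans (subadditive_natmul _ _).
by apply: phi_nd; rewrite mulrN lerN2 -ler_pdivlMr.
Qed.

(** Clearing the denominator absorbs the convention: when phi x = 0 both sides hold. *)
Let lte_Q r x : 0 < x -> (r%:E < Q x)%E = (r * phi x < x).
Proof.
move=> x0; rewrite /Q; case: ifPn => [/eqP ->|p0]; first by rewrite ltry mulr0 x0.
by rewrite lte_fin ltr_pdivlMr// lt_neqAle eq_sym p0 subadditive_ge0 ?ltW.
Qed.

Let Q_lte r x : 0 < x -> (Q (- x) < r%:E)%E = (x < r * - phi (- x)).
Proof.
move=> x0; rewrite /Q; case: ifPn => [/eqP ->|p0].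
  by rewrite oppr0 mulr0 ltNge leey ltNge ltW.
have p1 : 0 < - phi (- x).
  rewrite lt_neqAle eq_sym oppr_eq0 p0 oppr_ge0 -phi0.
  by apply: phi_nd; rewrite oppr_le0 ltW.
by rewrite lte_fin -[X in _ / X]opprK invrN mulrNN ltr_pdivrMr.
Qed.

(** From 0 = phi (x - x) <= phi x + phi (- x), that is - phi (- x) <= phi x. *)
Lemma subadditive_quotient_le x : 0 < x -> (Q x <= Q (- x))%E.
Proof.
move=> x0; have p := subadditive_oppr x.
rewrite /Q; case: (ifPn (phi (- x) == 0)) => [_|pN0]; first by rewrite leey.
have p1 : 0 < - phi (- x).
  rewrite lt_neqAle eq_sym oppr_eq0 pN0 oppr_ge0 -phi0.
  by apply: phi_nd; rewrite oppr_le0 ltW.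
have p2 := lt_le_trans p1 p.
rewrite gt_eqF// lee_fin -[X in _ <= _ / X]opprK invrN mulrNN ler_pM2l//.
by rewrite lef_pV2.
Qed.

(* Fekete's lemma: the quotients converge to their supremum, resp. infimum. *)
Lemma subadditive_cvgy :
  Q x @[x --> +oo%R] --> ereal_sup [set Q x | x in [set x : R | 0 < x]].
Proof.
apply: cvge_orderP => r.
  move=> /ereal_sup_gt[_ [x0 /= x0_gt0 <-]]; rewrite lte_Q// => hr.
  have [r0|r0] := leP 0 r; last first.
    near=> x; have x_gt0 : 0 < x by near: x; exact: nbhs_pinfty_gt.
    rewrite lte_Q//; apply: le_lt_trans x_gt0.
    by rewrite mulr_le0_ge0 ?(ltW r0)// subadditive_ge0 ?ltW.
  (* The slope r phi(x0)/x0 is below 1, so for large x the gap to 1 outweighs the additive error r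
     phi(x0) of the rounding. *)
  have k0 : 0 < 1 - r * phi x0 / x0 by rewrite subr_gt0 ltr_pdivrMr// mul1r.
  near=> x; have x_gt0 : 0 < x by near: x; exact: nbhs_pinfty_gt.
  rewrite lte_Q//.
  have : r * phi x0 / (1 - r * phi x0 / x0) < x.
    by near: x; apply: nbhs_pinfty_gt; exact: num_real.
  rewrite ltr_pdivrMr// => h.
  apply: (le_lt_trans (ler_wpM2l r0 (subadditive_le x0_gt0 (ltW x_gt0)))).
  have -> : r * ((x / x0 + 1) * phi x0) = x * (r * phi x0 / x0) + r * phi x0.
    by field; rewrite gt_eqF.
  by rewrite mulrBr mulr1 in h; lra.
move=> h; near=> x; apply: le_lt_trans h; apply: ereal_sup_ubound.
by exists x => //=; near: x; exact: nbhs_pinfty_gt.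
Unshelve. all: by end_near. Qed.

Lemma subadditive_cvgNy :
  Q x @[x --> -oo%R] --> ereal_inf [set Q (- x) | x in [set x : R | 0 < x]].
Proof.
apply/cvgNy_compNP; apply: cvge_orderP => r; last first.
  move=> /ereal_inf_lt[_ [x0 /= x0_gt0 <-]]; rewrite Q_lte// => hr.
  have p0 : 0 <= - phi (- x0).
    by rewrite oppr_ge0 -phi0; apply: phi_nd; rewrite oppr_le0 ltW.
  have r0 : 0 <= r by rewrite leNgt; apply/negP => r0; nra.
  (* Now the slope exceeds 1, and for large x the surplus pays for the rounding error. *)
  have k0 : 0 < r * - phi (- x0) / x0 - 1 by rewrite subr_gt0 ltr_pdivlMr// mul1r.
  near=> x; have x_gt0 : 0 < x by near: x; exact: nbhs_pinfty_gt.
  rewrite /= Q_lte//.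
  have : r * - phi (- x0) / (r * - phi (- x0) / x0 - 1) < x.
    by near: x; apply: nbhs_pinfty_gt; exact: num_real.
  rewrite ltr_pdivrMr// => h.
  apply: (lt_le_trans _
    (ler_wpM2l r0 (subadditive_oppr_ge x0_gt0 (ltW x_gt0)))).
  have -> : r * ((x / x0 - 1) * - phi (- x0)) =
      x * (r * - phi (- x0) / x0) - r * - phi (- x0).
    by field; rewrite gt_eqF.
  by rewrite mulrBr mulr1 in h; lra.
move=> h; near=> x; apply: (lt_le_trans h); apply: ereal_inf_lbound.
by exists x => //=; near: x; exact: nbhs_pinfty_gt.
Unshelve. all: by end_near. Qed.

(** The pointwise inequality compares Q x with Q (- x) at the same x only; passing to the limit on
    both sides compares the supremum with the infimum. *)
Lemma subadditive_sup_le_inf :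
  (ereal_sup [set Q x | x in [set x : R | 0 < x]%R] <=
   ereal_inf [set Q (- x)%R | x in [set x : R | 0 < x]%R])%E.
Proof.
have c1 := subadditive_cvgy; have := subadditive_cvgNy.
move=> /cvgNy_compNP c2; apply: (lee_cvg_to c1 c2).
near=> x; apply: subadditive_quotient_le.
by near: x; exact: nbhs_pinfty_gt.
Unshelve. all: by end_near. Qed.

End Subadditive.

Lemma powR_expR (R : realType) (a x : R) : 0 < a -> a `^ x = expR (x * ln a).
Proof. by move=> a0; rewrite /powR gt_eqF. Qed.

Lemma gt_real_between (R : realType) (x : R) (y : \bar R) : (x%:E < y)%E ->
  exists2 r : R, x < r & (r%:E < y)%E.
Proof.
case: y => [y| |//]; last by move=> _; exists (x + 1); rewrite ?ltry// ltrDl.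
by rewrite lte_fin => xy; exists ((x + y) / 2); rewrite ?lte_fin; lra.
Qed.

Lemma lt_real_between (R : realType) (x : \bar R) (y : R) : 0 < y ->
  (x < y%:E)%E -> exists2 r : R, 0 < r < y & (x < r%:E)%E.
Proof.
case: x => [x| //|] y0.
  rewrite lte_fin => xy; have [x0|x0] := leP 0 x.
    by exists ((x + y) / 2); rewrite ?lte_fin; [apply/andP; split|]; lra.
  by exists (y / 2); rewrite ?lte_fin; [apply/andP; split|]; lra.
by exists (y / 2); rewrite ?ltNyr//; apply/andP; split; lra.
Qed.

(** * The dilation norm and its growth exponents *)

Section DilationNorm.
Variables (R : realType) (E : symmetric_quasi_Banach R).
Implicit Types (f g : R -> R) (a b s r : R).

Local Notation car := (sqb_carrier E).
Local Notation nrm := (sqb_norm E).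
Local Notation N := (dilation_norm E).

Lemma sqb_norm_cst0 : nrm (cst 0) = 0.
Proof. by apply/(sqb_norm_eq0 (@sqb_zero _ E)); exact: aeW. Qed.

Let unit_ball_image_nonempty a :
  [set nrm (dilation a f) | f in [set f | car f /\ nrm f <= 1]] !=set0.
Proof.
exists (nrm (dilation a (cst 0))); exists (cst 0) => //; split.
  exact: sqb_zero.
by rewrite sqb_norm_cst0.
Qed.

Lemma dilation_norm_le a M : 0 <= M ->
  (forall f, car f -> nrm (dilation a f) <= M * nrm f) -> N a <= M.
Proof.
move=> M0 h; apply: ge_sup => // _ [f [Ef f1] <-].
by apply: (le_trans (h _ Ef)); rewrite -[leRHS]mulr1 ler_wpM2l.
Qed.

(** Boundedness of dilations enters here: it makes [sup] a true supremum rather than a default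
    value. Homogeneity then extends the bound beyond the unit ball. *)
Lemma dilation_norm_ub a f : 0 < a -> car f ->
  nrm (dilation a f) <= N a * nrm f.
Proof.
move=> a0 Ef; have [C C0 hC] := sqb_dilation E a0.
have f0 := sqb_norm_ge0 Ef.
have [fE|fn0] := eqVneq (nrm f) 0.
  by have := (hC _ Ef).2; rewrite fE !mulr0.
have fp : 0 < nrm f by rewrite lt_neqAle eq_sym fn0.
pose g := (nrm f)^-1 \*o f.
have Eg : car g by exact: sqb_scale.
have ng : nrm g = 1 by rewrite sqb_normZ// gtr0_norm ?invr_gt0// mulVf.
have -> : nrm (dilation a f) = nrm (dilation a g) * nrm f.
  have -> : dilation a g = (nrm f)^-1 \*o dilation a f by [].
  rewrite (sqb_normZ _ (hC _ Ef).1) gtr0_norm ?invr_gt0// mulrAC mulVf//.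
  by rewrite mul1r.
apply: ler_wpM2r => //; apply: ub_le_sup.
  exists C => _ [k [Ek k1] <-]; apply: (le_trans (hC _ Ek).2).
  by rewrite -[leRHS]mulr1 ler_wpM2l.
by exists g => //; split => //; rewrite ng.
Qed.

Lemma sqb_carrier_dilation a f : 0 < a -> car f -> car (dilation a f).
Proof.
by move=> a0 Ef; have [C _ hC] := sqb_dilation E a0; exact: (hC _ Ef).1.
Qed.

Lemma dilation_norm_ge0 a : 0 < a -> 0 <= N a.
Proof.
move=> a0; have [f Ef fn0] := sqb_nonzero E.
have fp : 0 < nrm f by rewrite lt_neqAle eq_sym fn0 sqb_norm_ge0.
rewrite -(pmulr_lge0 _ fp); apply: le_trans (dilation_norm_ub a0 Ef).
by apply: sqb_norm_ge0; exact: sqb_carrier_dilation.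
Qed.

Lemma dilation_normM a b : 0 < a -> 0 < b -> N (a * b) <= N a * N b.
Proof.
move=> a0 b0; apply: dilation_norm_le.
  by apply: mulr_ge0; exact: dilation_norm_ge0.
move=> f Ef; rewrite -dilationM; have Ebf := sqb_carrier_dilation b0 Ef.
apply: (le_trans (dilation_norm_ub a0 Ebf)).
rewrite -mulrA; apply: ler_wpM2l; first exact: dilation_norm_ge0.
exact: dilation_norm_ub.
Qed.

Lemma dilation_norm_le1 a : 1 <= a -> N a <= 1.
Proof.
by move=> a1; apply: dilation_norm_le => // f Ef;
  rewrite mul1r; exact: (sqb_dilation_ge1 a1 Ef).2.
Qed.

Lemma dilation_norm1 : N 1 = 1.
Proof.
apply/eqP; rewrite eq_le dilation_norm_le1//=.
have [f Ef fn0] := sqb_nonzero E.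
have fp : 0 < nrm f by rewrite lt_neqAle eq_sym fn0 sqb_norm_ge0.
rewrite -(ler_pM2r fp) mul1r.
have := dilation_norm_ub ltr01 Ef.
by have -> : dilation 1 f = f by apply/funext => s; rewrite /dilation mul1r.
Qed.

(** Otherwise 1 = N 1 <= N a N(1/a) would vanish. Positivity gives the logarithms below their
    meaning. *)
Lemma dilation_norm_gt0 a : 0 < a -> 0 < N a.
Proof.
move=> a0; have ai : 0 < a^-1 by rewrite invr_gt0.
rewrite lt_neqAle dilation_norm_ge0// andbT eq_sym; apply/eqP => Na.
have := dilation_normM a0 ai.
by rewrite divff ?gt_eqF// dilation_norm1 Na mul0r ler10.
Qed.

Lemma dilation_norm_ni a b : 0 < a -> a <= b -> N b <= N a.
Proof.
move=> a0 ab; have b0 := lt_le_trans a0 ab.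
have -> : b = b / a * a by rewrite divfK// gt_eqF.
have ba0 : 0 < b / a by rewrite divr_gt0.
apply: (le_trans (dilation_normM ba0 a0)).
rewrite -[leRHS]mul1r; apply: ler_wpM2r; first exact: dilation_norm_ge0.
by apply: dilation_norm_le1; rewrite ler_pdivlMr// mul1r.
Qed.

Lemma dilation_normX a n : 0 < a -> N (a ^+ n) <= N a ^+ n.
Proof.
move=> a0; elim: n => [|n IH]; first by rewrite !expr0 dilation_norm1.
rewrite !exprS; apply: (le_trans (dilation_normM a0 (exprn_gt0 n a0))).
by apply: ler_wpM2l => //; exact: dilation_norm_ge0.
Qed.

(** The substitution s = e^x turns submultiplicativity of N into subadditivity, and N nonincreasing
    into phi nondecreasing. *)
Let phi x := ln (N (expR (- x))).

Let phiD x y : phi (x + y) <= phi x + phi y.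
Proof.
have px : N (expR (- x)) \is Num.pos.
  by rewrite posrE; apply: dilation_norm_gt0; exact: expR_gt0.
have py : N (expR (- y)) \is Num.pos.
  by rewrite posrE; apply: dilation_norm_gt0; exact: expR_gt0.
rewrite /phi -lnM// ler_ln ?rpredM//.
  by rewrite opprD expRD; apply: dilation_normM; exact: expR_gt0.
by rewrite posrE; apply: dilation_norm_gt0; exact: expR_gt0.
Qed.

Let phi_nd : {homo phi : x y / x <= y}.
Proof.
move=> x y xy; rewrite /phi ler_ln.
- by apply: dilation_norm_ni; [exact: expR_gt0|rewrite ler_expR lerN2].
- by rewrite posrE; apply: dilation_norm_gt0; exact: expR_gt0.
- by rewrite posrE; apply: dilation_norm_gt0; exact: expR_gt0.
Qed.

Let phi0 : phi 0 = 0.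
Proof. by rewrite /phi oppr0 expR0 dilation_norm1 ln1. Qed.

Let Q x := if phi x == 0 then +oo%E else (x / phi x)%:E.

Let boyd_quotientE s : 0 < s -> boyd_quotient E s = Q (ln s).
Proof. by move=> s0; rewrite /Q /phi expRN lnK. Qed.

Let cvg_lower : boyd_quotient E s @[s --> +oo] -->
  ereal_sup [set Q x | x in [set x : R | 0 < x]].
Proof.
apply: (@cvg_trans _ (Q (ln s) @[s --> +oo])).
  apply: near_eq_cvg; near=> s; apply/esym/boyd_quotientE.
  by near: s; exact: nbhs_pinfty_gt.
apply: (@cvg_comp _ _ _ (@ln R) Q _ (pinfty_nbhs R)); last first.
  exact: subadditive_cvgy.
apply/cvgryPgt => A; near=> s.
have s0 : 0 < s by near: s; exact: nbhs_pinfty_gt.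
have As : expR A < s by near: s; apply: nbhs_pinfty_gt; exact: num_real.
by rewrite -ltr_expR lnK.
Unshelve. all: by end_near. Qed.

Let cvg_upper : boyd_quotient E s @[s --> 0^'+] -->
  ereal_inf [set Q (- x) | x in [set x : R | 0 < x]].
Proof.
apply: (@cvg_trans _ (Q (ln s) @[s --> 0^'+])).
  by apply: near_eq_cvg; near=> s; rewrite boyd_quotientE.
apply: (@cvg_comp _ _ _ (@ln R) Q _ (ninfty_nbhs R)); last first.
  exact: subadditive_cvgNy.
exact: lnNy.
Unshelve. all: by end_near. Qed.

(** The [lim] defining the index is a genuine limit, by Fekete's lemma after the substitution x = ln
    s. *)
Lemma cvg_lower_boyd : boyd_quotient E s @[s --> +oo] --> lower_boyd E.
Proof. by rewrite /lower_boyd (cvg_lim _ cvg_lower). Qed.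

Lemma cvg_upper_boyd : boyd_quotient E s @[s --> 0^'+] --> upper_boyd E.
Proof. by rewrite /upper_boyd (cvg_lim _ cvg_upper). Qed.

Lemma lower_boyd_le_upper : (lower_boyd E <= upper_boyd E)%E.
Proof.
rewrite /lower_boyd /upper_boyd (cvg_lim _ cvg_lower)// (cvg_lim _ cvg_upper)//.
exact: subadditive_sup_le_inf.
Qed.

Let ln_dilation_norm_ge0 s : 1 <= s -> 0 <= ln (N s^-1).
Proof.
move=> s1; rewrite ln_ge0// -[leLHS]dilation_norm1; apply: dilation_norm_ni.
  by rewrite invr_gt0; exact: lt_le_trans s1.
by rewrite invf_le1//; exact: lt_le_trans s1.
Qed.

Let ln_dilation_norm_le0 s : 0 < s -> s <= 1 -> ln (N s^-1) <= 0.
Proof.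
move=> s0 s1; apply: ln_le0; apply: dilation_norm_le1.
by rewrite -invr1 lef_pV2// ?posrE.
Qed.

Let dilation_norm_powR s r : 0 < s -> ln (N s^-1) <= r * ln s -> N s^-1 <= s `^ r.
Proof.
move=> s0 h; rewrite powR_expR//.
by rewrite -[leLHS]lnK ?posrE ?dilation_norm_gt0 ?invr_gt0// ler_expR.
Qed.

Let powR_dilation_norm s C r : 0 < s -> 0 < C -> N s^-1 <= C * s `^ r ->
  ln (N s^-1) <= ln C + r * ln s.
Proof.
move=> s0 C0 h; rewrite -ln_powR -lnM ?posrE ?powR_gt0//.
by rewrite ler_ln ?posrE ?dilation_norm_gt0 ?invr_gt0 ?mulr_gt0 ?powR_gt0.
Qed.

(** An exponent r strictly between p and the index leaves the slack from which geometric decay is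
    obtained later. A vanishing logarithm makes the quotient infinite, but then N(1/s) = 1 and the
    bound is clear. *)
Lemma lt_lower_boyd p : 0 < p -> (p%:E < lower_boyd E)%E ->
  exists2 r, p < r & \forall s \near +oo%R, N s^-1 <= s `^ r^-1.
Proof.
move=> p0 /gt_real_between[r pr rl]; exists r => //.
have r0 := lt_trans p0 pr.
near=> s; have s1 : 1 < s by near: s; exact: nbhs_pinfty_gt.
have s0 : 0 < s by exact: lt_trans s1.
have : (r%:E < boyd_quotient E s)%E.
  by near: s; exact: (cvg_lower_boyd (open_ereal_gt' rl)).
have n0 := ln_dilation_norm_ge0 (ltW s1); have l0 := ln_gt0 s1.
move=> h; apply: dilation_norm_powR => //; rewrite mulrC; move: h.
rewrite /boyd_quotient; case: ifPn => [/eqP-> _|nn].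
  by rewrite divr_ge0// ltW.
have np : 0 < ln (N s^-1) by rewrite lt_neqAle eq_sym nn.
by rewrite lte_fin ltr_pdivlMr// ler_pdivlMr// [X in X <= _]mulrC; exact: ltW.
Unshelve. all: by end_near. Qed.

(** For s < 1 both logarithms are nonpositive, so division reverses inequalities; a quotient below r
    rules out the infinite convention. *)
Lemma upper_boyd_lt q : 0 < q -> (upper_boyd E < q%:E)%E ->
  exists2 r, 0 < r < q & \forall s \near 0^'+, N s^-1 <= s `^ r^-1.
Proof.
move=> q0 /(lt_real_between q0)[r /andP[r0 rq] lr]; exists r; first by rewrite r0.
near=> s; have s0 : 0 < s by [].
have s1 : s < 1 by near: s; exact: nbhs_right_lt.
have : (boyd_quotient E s < r%:E)%E.
  by near: s; exact: (cvg_upper_boyd (open_ereal_lt' lr)).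
have n0 := ln_dilation_norm_le0 s0 (ltW s1).
move=> h; apply: dilation_norm_powR => //; rewrite mulrC; move: h.
rewrite /boyd_quotient; case: ifPn => // nn.
have np : ln (N s^-1) < 0 by rewrite lt_neqAle nn.
by rewrite lte_fin ltr_ndivrMr// ler_pdivlMr// [X in X <= _]mulrC; exact: ltW.
Unshelve. all: by end_near. Qed.

(** If the index were below some r < p, then ln s < r ln N(1/s) <= r ln C + (r/p) ln s for all large
    s, which fails since r/p < 1. *)
Lemma lower_boyd_ge p C : 0 < p -> 0 < C ->
  (forall s, 1 <= s -> N s^-1 <= C * s `^ p^-1) -> (p%:E <= lower_boyd E)%E.
Proof.
move=> p0 C0 h; rewrite leNgt; apply/negP.
move=> /(lt_real_between p0)[r /andP[r0 rp] lr].
suff : \forall s \near pinfty_nbhs R, False by move=> /filter_ex[].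
near=> s; have s1 : 1 < s by near: s; exact: nbhs_pinfty_gt.
have s0 : 0 < s by exact: lt_trans s1.
have : (boyd_quotient E s < r%:E)%E.
  by near: s; exact: (cvg_lower_boyd (open_ereal_lt' lr)).
have n0 := ln_dilation_norm_ge0 (ltW s1).
rewrite /boyd_quotient; case: ifPn => // nn.
have np : 0 < ln (N s^-1) by rewrite lt_neqAle eq_sym nn.
rewrite lte_fin ltr_pdivrMr// => h1.
have h2 := powR_dilation_norm s0 C0 (h _ (ltW s1)).
have : ln s < r * (ln C + p^-1 * ln s).
  by apply: (lt_le_trans h1); rewrite ler_pM2l.
apply/negP; rewrite -leNgt.
have k0 : 0 < 1 - r / p by rewrite subr_gt0 ltr_pdivrMr// mul1r.
have : expR (r * ln C / (1 - r / p)) < s.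
  by near: s; apply: nbhs_pinfty_gt; exact: num_real.
rewrite -[X in _ < X](lnK s0) ltr_expR.
rewrite ltr_pdivrMr// => h3; lra.
Unshelve. all: by end_near. Qed.

(** The same argument at 0: with r > q the inequality ln s < r ln C + (r/q) ln s fails as ln s tends
    to minus infinity. *)
Lemma upper_boyd_le q C : 0 < q -> 0 < C ->
  (forall s, 0 < s -> s <= 1 -> N s^-1 <= C * s `^ q^-1) ->
  (upper_boyd E <= q%:E)%E.
Proof.
move=> q0 C0 h; rewrite leNgt; apply/negP => /gt_real_between[r qr rl].
have r0 := lt_trans q0 qr.
suff : \forall s \near (0 : R)^'+, False by move=> /filter_ex[].
near=> s; have s0 : 0 < s by [].
have s1 : s < 1 by near: s; exact: nbhs_right_lt.
have : (r%:E < boyd_quotient E s)%E.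
  by near: s; exact: (cvg_upper_boyd (open_ereal_gt' rl)).
have n0 := ln_dilation_norm_le0 s0 (ltW s1).
move=> h1; have {}h1 : ln s < r * ln (N s^-1).
  move: h1; rewrite /boyd_quotient; case: ifPn => [/eqP-> _|nn].
    by rewrite mulr0 ln_lt0// s0.
  have np : ln (N s^-1) < 0 by rewrite lt_neqAle nn.
  by rewrite lte_fin ltr_ndivlMr.
have h2 := powR_dilation_norm s0 C0 (h _ s0 (ltW s1)).
have : ln s < r * (ln C + q^-1 * ln s).
  by apply: (lt_le_trans h1); rewrite ler_pM2l.
apply/negP; rewrite -leNgt.
have k0 : 0 < r / q - 1 by rewrite subr_gt0 ltr_pdivlMr// mul1r.
have : s < expR (- (r * ln C) / (r / q - 1)).
  by near: s; apply: nbhs_right_lt; exact: expR_gt0.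
rewrite -[X in X < _](lnK s0) ltr_expR.
rewrite ltr_pdivlMr// => h3; lra.
Unshelve. all: by end_near. Qed.

End DilationNorm.

(** * Tensor products *)

Section Tensor.
Variables (R : realType).
Implicit Types (f th : R -> R) (v c : R) (I : set R).

Local Notation lambda := (@lebesgue_measure R).
Local Notation Rplus2 := (Rplus (R:=R) `*` Rplus (R:=R)).
Local Notation dist := (distribution_function lambda (@Rplus R)).
Local Notation dist2 := (distribution_function (@lebesgue2 R) Rplus2).
Local Notation tensor f th := (fun st : R * R => f st.1 * th st.2).

Lemma measurable_tensor f th : measurable_fun (@Rplus R) f ->
  measurable_fun (@Rplus R) th -> measurable_fun Rplus2 (tensor f th).
Proof.
move=> mf mth.
have mR2 : measurable (Rplus2 : set (R * R)) by exact: measurableX.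
apply: measurable_funM.
- apply: (measurable_comp (F := @Rplus R)) => //.
  + by move=> _ [x [x1 x2] <-].
  + exact: measurable_funTS measurable_fst.
- apply: (measurable_comp (F := @Rplus R)) => //.
  + by move=> _ [x [x1 x2] <-].
  + exact: measurable_funTS measurable_snd.
Qed.

Lemma lebesgue2_superlevelX f v c I : 0 < c -> measurable_fun (@Rplus R) f ->
  measurable I ->
  lebesgue2 ((Rplus (R:=R) `&` [set s | v / c < `|f s|]) `*` I) =
  (dist f (v / c)%R * lambda I)%E.
Proof.
move=> c0 mf mI; rewrite /lebesgue2 product_measure1E//.
exact: measurable_superlevel.
Qed.

Lemma distribution_functionZ f v c : 0 < c ->
  dist (c \*o f) v = dist f (v / c).
Proof.
move=> c0; congr (lambda _); apply/seteqP.
by split => x [x0 /=]; rewrite normrM (gtr0_norm c0) ltr_pdivrMr// mulrC.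
Qed.

(** The rectangle of all (s, t) with |f s| > v/c and t in I lies in the superlevel set of the tensor
    product. *)
Lemma distribution_function_tensor_ge f th v c I :
  0 < c -> measurable_fun (@Rplus R) f -> measurable_fun Rplus2 (tensor f th) ->
  measurable I -> I `<=` @Rplus R -> (forall t, I t -> c <= th t) ->
  (lambda I * dist (c \*o f) v <= dist2 (tensor f th) v)%E.
Proof.
move=> c0 mf mF mI IR Ith.
rewrite distribution_functionZ// muleC -lebesgue2_superlevelX//.
apply: le_measure; rewrite ?inE.
- by apply: measurableX => //; exact: measurable_superlevel.
- by apply: measurable_superlevel => //; exact: measurableX.
move=> [s t] [/= [s0 vf] It]; split; first by split => //=; exact: IR.
have ct := Ith _ It.
move: vf; rewrite /= ltr_pdivrMr// normrM => vf; apply: (lt_le_trans vf).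
by apply: ler_wpM2l => //; apply: (le_trans ct); exact: ler_norm.
Qed.

End Tensor.

(** * Norm-convergent series as common majorants *)

Section DominatedSeries.
Variables (R : realType) (E : symmetric_quasi_Banach R).
Implicit Types (f g : R -> R) (X : nat -> R -> R).

Local Notation lambda := (@lebesgue_measure R).
Local Notation car := (sqb_carrier E).
Local Notation nrm := (sqb_norm E).

(** The n terms from index m on. The start is a parameter so that differences of partial sums are
    again block sums, and the first term is peeled off so that term m + j costs about j factors
    K. *)
Fixpoint block_sum X m n : R -> R :=
  if n is n'.+1 then X m \+ block_sum X m.+1 n' else cst 0.

Lemma block_sum_cat X k m n :
  block_sum X k (m + n) = block_sum X k m \+ block_sum X (k + m) n.
Proof.
elim: m k => [|m IH] k.
  by rewrite addn0; apply/funext => x /=; rewrite add0r.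
rewrite addSn /= IH addnS addSn; apply/funext => x /=; exact: addrA.
Qed.

Lemma block_sum_ge0 X k n x : (forall i, 0 <= X i x) -> 0 <= block_sum X k n x.
Proof. by move=> X0; elim: n k => [//|n IH] k /=; exact: addr_ge0. Qed.

Variable K : R.
Hypothesis K1 : 1 <= K.
Hypothesis normD : forall f g, car f -> car g ->
  nrm (f \+ g) <= K * (nrm f + nrm g).

Variables (X : nat -> R -> R) (M : R).
Hypothesis M0 : 0 <= M.
Hypothesis EX : forall n, car (X n).
Hypothesis X_ge0 : forall n x, 0 <= X n x.
Hypothesis nX : forall n, nrm (X n) <= M * (2 * K)^-1 ^+ n.

Let k2 : 0 < (2 * K)^-1.
Proof. by rewrite invr_gt0 mulr_gt0// (lt_le_trans _ K1). Qed.

Let Eblock k n : car (block_sum X k n).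
Proof.
by elim: n k => [|n IH] k /=; [exact: sqb_zero|exact: sqb_add].
Qed.

(* The ratio 1/(2K) beats the constant K lost at each use of the quasi-triangle
   inequality. *)
Let block_sum_norm k n : nrm (block_sum X k n) <= 2 * K * M * (2 * K)^-1 ^+ k.
Proof.
have [k1 m0] := (K1, M0).
elim: n k => [|n IH] k /=.
  by rewrite sqb_norm_cst0; apply: mulr_ge0; [nra|by rewrite exprn_ge0// ltW].
apply: (le_trans (normD (EX _) (Eblock _ _))).
have -> : 2 * K * M * (2 * K)^-1 ^+ k =
    K * (M * (2 * K)^-1 ^+ k + 2 * K * M * (2 * K)^-1 ^+ k.+1).
  by rewrite exprS; field; rewrite gt_eqF//; lra.
by apply: ler_wpM2l; [lra|exact: lerD].
Qed.

(** The partial sums [u] are Cauchy, and g is their limit in norm. Since the terms are nonnegative,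
    X n <= u (n+1), and it remains to compare u (n+1) with g almost everywhere. *)
Lemma sqb_dominated_series : exists g,
  [/\ car g, nrm g <= 2 * K ^+ 2 * M &
    forall n, {ae lambda, forall x, Rplus x -> X n x <= `|g x|}].
Proof.
have [k1 m0] := (K1, M0).
pose u n := block_sum X 0 n.
have Eu n : car (u n) by exact: Eblock.
have Edist f g : car f -> car g -> car (f \- g).
  move=> Ef Eg; have -> : f \- g = f \+ (-1) \*o g.
    by apply/funext => x /=; rewrite mulN1r.
  by apply: sqb_add => //; exact: sqb_scale.
have swap f g : car f -> car g -> nrm (f \- g) = nrm (g \- f).
  move=> Ef Eg; have -> : f \- g = (-1) \*o (g \- f).
    by apply/funext => x /=; rewrite mulN1r opprB.
  by rewrite sqb_normZ ?normrN ?normr1 ?mul1r//; exact: Edist.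
have diff i j : (i <= j)%N ->
    nrm (u i \- u j) <= 2 * K * M * (2 * K)^-1 ^+ i.
  move=> ij; rewrite swap//.
  have -> : u j \- u i = block_sum X i (j - i).
    apply/funext => x; rewrite /u /= -{1}(subnKC ij) block_sum_cat add0n /=.
    by rewrite addrC addKr.
  exact: block_sum_norm.
have small (e : R) : 0 < e -> exists n, 2 * K * M * (2 * K)^-1 ^+ n < e.
  move=> e0; have c : 2 * K * M * (2 * K)^-1 ^+ n @[n --> \oo] --> 0.
    rewrite -(mulr0 (2 * K * M)); apply: cvgMr; apply: cvg_expr.
    by rewrite gtr0_norm// invf_lt1; lra.
  have /cvgr0Pnorm_lt /(_ e e0)[n _ /(_ n (leqnn n)) /= h] := c.
  by exists n; exact: le_lt_trans (ler_norm _) h.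
have anti i j : (i <= j)%N ->
    2 * K * M * (2 * K)^-1 ^+ j <= 2 * K * M * (2 * K)^-1 ^+ i.
  move=> ij; apply: ler_wpM2l; first by rewrite mulr_ge0//; lra.
  by apply: ler_wiXn2l => //; [exact: ltW|rewrite invf_le1; lra].
have [|g Eg ug] := @sqb_complete _ E u Eu.
  move=> e e0; have [n hn] := small e e0; exists n => i j ni nj.
  have [ij|/ltnW ji] := leqP i j.
    by apply: (le_lt_trans (diff _ _ ij)); exact: le_lt_trans (anti _ _ ni) hn.
  rewrite swap//; apply: (le_lt_trans (diff _ _ ji)).
  exact: le_lt_trans (anti _ _ nj) hn.
have lim (e : R) k : 0 < e -> exists2 n, (k <= n)%N & nrm (u n \- g) < e.
  move=> e0; have /cvgr0Pnorm_lt /(_ e e0)[n _ h] := ug.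
  exists (maxn k n); first exact: leq_maxl.
  by apply: (le_lt_trans (ler_norm _)); apply: h; exact: leq_maxr.
exists g; split => //.
  (* Splitting g as u n + (g - u n) costs a second factor K, whence K^2; the error e/K becomes e. *)
  apply/ler_addgt0Pr => e e0.
  have eK : 0 < e / K by rewrite divr_gt0//; lra.
  have [n _ hn] := lim (e / K) 0%N eK.
  have -> : g = u n \+ (g \- u n) by apply/funext => x /=; rewrite addrC subrK.
  apply: (le_trans (normD (Eu n) (Edist _ _ Eg (Eu n)))).
  have -> : 2 * K ^+ 2 * M + e = K * (2 * K * M + e / K).
    by field; rewrite gt_eqF//; lra.
  apply: ler_wpM2l; first lra.
  apply: lerD; last by rewrite swap//; exact: ltW.
  by have := block_sum_norm 0 n; rewrite expr0 mulr1.
(* The positive part of u (n+1) - g. As [u] increases, h <= |u m - g| for every m > n, so h has norm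
   0 and vanishes almost everywhere. *)
move=> n; pose h x := Num.max 0 (u n.+1 x - g x).
have mh : measurable_fun (@Rplus R) h.
  apply: measurable_maxr => //; apply: measurable_funB.
    exact: sqb_measurable (Eu _).
  exact: sqb_measurable Eg.
have hle m : (n.+1 <= m)%N -> car h /\ nrm h <= nrm (u m \- g).
  move=> nm; apply: sqb_dom => //; first exact: Edist.
  move=> x _; rewrite /h ger0_norm ?le_max ?lexx//= ge_max normr_ge0/=.
  apply: le_trans (ler_norm _); rewrite lerD2r /u -(subnKC nm) block_sum_cat/=.
  by rewrite lerDl; exact: block_sum_ge0.
have [Eh _] := hle _ (leqnn _).
have nh : nrm h = 0.
  apply/eqP; rewrite eq_le sqb_norm_ge0// andbT.
  apply/ler_addgt0Pr => e e0; rewrite add0r.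
  have [m nm hm] := lim e n.+1 e0.
  by apply: (le_trans (hle _ nm).2); exact: ltW.
have h0 := (sqb_norm_eq0 Eh).1 nh.
apply: (@filterS _ _ (ae_filter_ringOfSetsType lambda) _ _ _ h0).
move=> x hx Rx.
apply: (@le_trans _ _ (u n.+1 x)).
  rewrite /u -addn1 block_sum_cat /= addr0 add0n lerDr.
  exact: block_sum_ge0.
apply: le_trans (ler_norm _); rewrite -subr_le0 -(hx Rx) /h.
by rewrite le_max lexx orbT.
Qed.

End DominatedSeries.

(** * Tensor products with functions decaying geometrically on blocks *)

Section TensorBound.
Variables (R : realType) (E : symmetric_quasi_Banach R).

Local Notation lambda := (@lebesgue_measure R).
Local Notation car := (sqb_carrier E).
Local Notation nrm := (sqb_norm E).
Local Notation N := (dilation_norm E).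
Local Notation dist := (distribution_function lambda (@Rplus R)).
Local Notation Rplus2 := (Rplus (R:=R) `*` Rplus (R:=R)).
Local Notation dist2 := (distribution_function (@lebesgue2 R) Rplus2).

(** Submultiplicativity bounds the norm of c^n D_{w a^n} f by N(w) (c N(a))^n times that of f, and c
    N(a) <= 1/(2K) is the ratio that [sqb_dominated_series] requires. *)
Lemma sqb_dominated_dilations (K a c w : R) : 1 <= K ->
  (forall f g, car f -> car g -> nrm (f \+ g) <= K * (nrm f + nrm g)) ->
  0 < a -> 0 < c -> 0 < w -> 2 * K * (c * N a) <= 1 ->
  exists2 C, 0 <= C & forall f, car f -> exists g, [/\ car g, nrm g <= C * nrm f &
    forall n, {ae lambda, forall x, Rplus x ->
      c ^+ n * `|dilation (w * a ^+ n) f x| <= `|g x|}].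
Proof.
move=> K1 hK a0 c0 w0 hc.
have Nw := dilation_norm_ge0 E w0; have Na := dilation_norm_ge0 E a0.
exists (2 * K ^+ 2 * N w); first by rewrite !mulr_ge0//; lra.
move=> f Ef.
have wa n : 0 < w * a ^+ n by rewrite mulr_gt0// exprn_gt0.
pose X n x := c ^+ n * `|dilation (w * a ^+ n) f x|.
have Dcar n : car (dilation (w * a ^+ n) f) by exact: sqb_carrier_dilation.
have Acar n : car (fun x => `|dilation (w * a ^+ n) f x|) /\
    nrm (fun x => `|dilation (w * a ^+ n) f x|) <= nrm (dilation (w * a ^+ n) f).
  apply: sqb_dom => //; last by move=> x _; rewrite normr_id.
  by apply: measurableT_comp => //; exact: sqb_measurable (Dcar n).
have f0 := sqb_norm_ge0 Ef.
have M0 : 0 <= N w * nrm f by exact: mulr_ge0.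
have EX n : car (X n) by apply: sqb_scale; exact: (Acar n).1.
have X0 n x : 0 <= X n x by rewrite mulr_ge0// exprn_ge0// ltW.
have nX n : nrm (X n) <= N w * nrm f * (2 * K)^-1 ^+ n.
  rewrite (sqb_normZ _ (Acar n).1) ger0_norm ?exprn_ge0 ?(ltW c0)//.
  apply: (@le_trans _ _ (c ^+ n * (N w * N a ^+ n * nrm f))).
    apply: ler_wpM2l; first by rewrite exprn_ge0// ltW.
    apply: (le_trans (Acar n).2); apply: (le_trans (dilation_norm_ub (wa n) Ef)).
    apply: ler_wpM2r => //.
    apply: (le_trans (dilation_normM E w0 (exprn_gt0 n a0))).
    by apply: ler_wpM2l => //; exact: dilation_normX.
  rewrite [leLHS](_ : _ = N w * nrm f * (c * N a) ^+ n); last first.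
    by rewrite exprMn; ring.
  apply: ler_wpM2l => //; apply: lerXn2r; rewrite ?nnegrE.
  - by rewrite mulr_ge0// ltW.
  - by rewrite invr_ge0; lra.
  - by rewrite -[leRHS]mul1r ler_pdivlMr; lra.
have [g [Eg ng dom]] := sqb_dominated_series K1 hK M0 EX X0 nX.
by exists g; split => //; rewrite -!mulrA in ng *.
Qed.

(* The function g dominates b c^n |D_{w a^n} f| for all n, with w = 1/(4l), so the
   n-th term |I_n| dist f (v / (b c^n)) is at most (1/4) 2^-n dist g v. *)
Lemma tensor_bound (th : R -> R) (I : nat -> set R) (K a c l rho b : R) :
  1 <= K ->
  (forall f g, car f -> car g -> nrm (f \+ g) <= K * (nrm f + nrm g)) ->
  0 < a -> 0 < c -> 0 < rho -> 0 < l -> 0 < b ->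
  2 * K * (c * N a) <= 1 -> a * rho <= 2^-1 ->
  measurable_fun (@Rplus R) th ->
  (forall n, measurable (I n)) ->
  (forall n, (lambda (I n) <= (l * rho ^+ n)%:E)%E) ->
  (forall n t, I n t -> `|th t| <= b * c ^+ n) ->
  (forall t, Rplus t -> th t != 0 -> exists n, I n t) ->
  exists2 C, 0 <= C & forall f, car f -> exists g, [/\ car g, nrm g <= C * nrm f &
    forall v, 0 < v ->
      (dist2 (fun st => (f st.1 * th st.2)%R) v <= 2^-1%:E * dist g v)%E].
Proof.
move=> K1 hK a0 c0 rho0 l0 b0 hc harho mth mI lI thI cover.
pose w := (4 * l)^-1; have w0 : 0 < w by rewrite invr_gt0; lra.
have [C C0 hC] := sqb_dominated_dilations K1 hK a0 c0 w0 hc.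
exists (b * C); first by rewrite mulr_ge0// ltW.
move=> f Ef; have [g [Eg ng dom]] := hC f Ef.
exists (b \*o g); split; first exact: sqb_scale.
  by rewrite sqb_normZ// gtr0_norm// -mulrA ler_pM2l.
move=> v v0.
have mf := sqb_measurable Ef.
have bc n : 0 < b * c ^+ n by rewrite mulr_gt0// exprn_gt0.
have an n : 0 < w * a ^+ n by rewrite mulr_gt0// exprn_gt0.
pose S n : set (R * R) :=
  (Rplus (R:=R) `&` [set s | v / (b * c ^+ n) < `|f s|]) `*` I n.
have mS n : measurable (S n).
  by apply: measurableX => //; exact: measurable_superlevel.
have mR2 : measurable (Rplus2 : set (R * R)) by exact: measurableX.
have sub : Rplus2 `&` [set st | v < `|f st.1 * th st.2|] `<=` \bigcup_n S n.
  move=> [s t] [/= [s0 t0]]; rewrite normrM => vf.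
  have [||n Int] := cover t.
  - exact: t0.
  - by apply/eqP => th0; move: vf; rewrite th0 normr0 mulr0 ltNge ltW.
  exists n => //; split => //=; split => //=.
  rewrite ltr_pdivrMr//; apply: (lt_le_trans vf).
  by apply: ler_wpM2l => //; exact: thI.
have := distribution_function_ge0 lambda (@Rplus R) (b \*o g) v.
case dg : (dist (b \*o g) v) => [d| |] // d0; last first.
  by rewrite gt0_muley ?leey// lte_fin.
rewrite lee_fin in d0.
rewrite /distribution_function.
have mF : measurable (Rplus2 `&` [set st | v < `|f st.1 * th st.2|]).
  by apply: measurable_superlevel => //; exact: measurable_tensor.
have step : (lebesgue2 (Rplus2 `&` [set st | (v < `|f st.1 * th st.2|)%R]) <=
    \sum_(n <oo) lebesgue2 (S n))%E.
  by rewrite /lebesgue2; exact: measure_sigma_subadditive.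
apply: (le_trans step).
(* The bound is (d/4) 2^(-n), written so that [epsilon_trick0] sums it to d/2. *)
have term n : (lebesgue2 (S n) <= ((d / 2) / (2 ^ n.+1)%:R)%:E)%E.
  rewrite lebesgue2_superlevelX//.
  (* Undo the dilation: d(.; f) is w a^n times the distribution function of D_{w a^n} f, and g
     controls the latter. *)
  have h : (dist f (v / (b * c ^+ n)) <= (w * a ^+ n * d)%:E)%E.
    have h : (dist (dilation (w * a ^+ n) f) (v / (b * c ^+ n)) <= d%:E)%E.
      rewrite -distribution_functionZ// -dg; apply: ae_distribution_function_dom.
      - apply: measurable_funM => //.
        by apply: measurable_dilation => //; exact: ltW (an n).
      - by apply: measurable_funM => //; exact: sqb_measurable Eg.
      apply: (@filterS _ _ (ae_filter_ringOfSetsType lambda) _ _ _ (dom n)).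
      move=> x hx Rx /=.
      rewrite !normrM (gtr0_norm b0) (gtr0_norm (exprn_gt0 n c0)) -mulrA.
      by rewrite ler_pM2l//; exact: hx.
    move: h; rewrite distribution_function_dilation// => h.
    have an0 : w * a ^+ n != 0 by rewrite gt_eqF.
    rewrite EFinM -[leLHS]mul1e -(divff an0) EFinM -muleA.
    by apply: lee_wpmul2l => //; rewrite lee_fin ltW.
  apply: (@le_trans _ _ ((w * a ^+ n * d)%:E * (l * rho ^+ n)%:E)%E).
    by apply: lee_pmul.
  rewrite -EFinM lee_fin.
  have -> : w * a ^+ n * d * (l * rho ^+ n) = d / 4 * (a * rho) ^+ n.
    by rewrite /w exprMn; field; rewrite gt_eqF.
  have -> : d / 2 / (2 ^ n.+1)%:R = d / 4 * 2^-1 ^+ n.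
    by rewrite natrX exprS exprVn; field; rewrite expf_neq0.
  apply: ler_wpM2l; first by rewrite divr_ge0.
  by apply: lerXn2r; rewrite ?nnegrE// ?mulr_ge0// ltW.
apply: (@le_trans _ _ (\sum_(n <oo) ((d / 2) / (2 ^ n.+1)%:R)%:E)%E).
  by apply: lee_nneseries => // n _; exact: term.
apply: (le_trans (epsilon_trick0 _ _)); first by rewrite divr_ge0.
by rewrite -EFinM lee_fin mulrC.
Qed.

End TensorBound.

(** * The operator [Theta]: necessity, then sufficiency *)

Section Theta.
Variables (R : realType) (E : symmetric_quasi_Banach R).
Implicit Types (p q r s t x y : R) (f g : R -> R).

Local Notation lambda := (@lebesgue_measure R).
Local Notation car := (sqb_carrier E).
Local Notation nrm := (sqb_norm E).
Local Notation N := (dilation_norm E).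
Local Notation Rplus2 := (Rplus (R:=R) `*` Rplus (R:=R)).
Local Notation dist := (distribution_function lambda (@Rplus R)).
Local Notation dist2 := (distribution_function (@lebesgue2 R) Rplus2).

Lemma indic_head t : \1_(`]0, 1[%classic) t = (0 < t < 1)%R%:R :> R.
Proof. by rewrite indicE mem_setE in_itv. Qed.

Lemma indic_tail t : \1_(`[1, +oo[%classic) t = (1 <= t)%R%:R :> R.
Proof. by rewrite indicE mem_setE in_itv/= andbT. Qed.

Lemma theta_lt1 p q t : 0 < t -> t < 1 -> theta p q t = t `^ (- q^-1).
Proof.
move=> t0 t1; rewrite /theta indic_head indic_tail t0 t1 leNgt t1.
by rewrite mulr1 mulr0 addr0.
Qed.

Lemma theta_ge1 p q t : 1 <= t -> theta p q t = t `^ (- p^-1).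
Proof.
move=> t1; rewrite /theta indic_head indic_tail t1 [t < 1]ltNge t1 andbF.
by rewrite mulr1 mulr0 add0r.
Qed.

Lemma measurable_theta_part p (I : set R) : measurable I ->
  measurable_fun (@Rplus R) (fun t => t `^ p * \1_I t).
Proof.
move=> mI; apply: measurable_funM; last exact: measurable_indic.
by apply: measurable_funTS; exact: measurable_powR.
Qed.

Lemma powR_le_inv x y r : 0 < x -> x <= y -> 0 < r ->
  y `^ (- r^-1) <= x `^ (- r^-1).
Proof.
move=> x0 xy r0; have y0 := lt_le_trans x0 xy.
rewrite !powR_expR// ler_expR !mulNr lerN2 ler_pM2l ?invr_gt0//.
by rewrite ler_ln ?posrE.
Qed.

Lemma measurable_Theta p q f : measurable_fun (@Rplus R) f ->
  measurable_fun Rplus2 (Theta p q f).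
Proof.
move=> mf; apply: measurable_tensor => //.
by apply: measurable_funD; exact: measurable_theta_part.
Qed.

(** The function c D_{1/s} f has distribution function s d(v/c; f), at most that of [Theta p q f] by
    the rectangle bound. One constant serves all s, c and J. *)
Lemma bounded_Theta_dilation_norm p q : bounded_into_E2 E (Theta p q) ->
  exists2 C, 0 < C & forall s c (J : set R), 0 < s -> 0 < c -> measurable J ->
    J `<=` @Rplus R -> lambda J = s%:E -> (forall t, J t -> c <= theta p q t) ->
    N s^-1 <= C / c.
Proof.
(* The given C may be nonpositive, while its logarithm is taken later. *)
move=> [hE [C hC]]; exists (Num.max C 1); first by rewrite lt_max ltr01 orbT.
move=> s c J s0 c0 mJ JR lJ cJ; have C0 : 0 < Num.max C 1.
  by rewrite lt_max ltr01 orbT.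
apply: dilation_norm_le; first by rewrite divr_ge0// ltW.
move=> f Ef; have mf := sqb_measurable Ef.
have si : 0 < s^-1 by rewrite invr_gt0.
have ED := sqb_carrier_dilation si Ef.
have [SF EF] := hE f Ef.
have mR2 : measurable (Rplus2 : set (R * R)) by exact: measurableX.
have tr := rearrangement_sqb (f := c \*o dilation s^-1 f) _ SF EF.
have [|v v0|_] := tr mR2.
- by apply: measurable_funM => //; exact: sqb_measurable ED.
- rewrite distribution_functionZ// distribution_function_dilation// invrK.
  rewrite -distribution_functionZ// -lJ.
  by apply: distribution_function_tensor_ge => //; exact: measurable_Theta.
rewrite (sqb_normZ _ ED) gtr0_norm// => h.
rewrite mulrAC ler_pdivlMr// mulrC; apply: (le_trans h).
apply: (le_trans (hC f Ef)); apply: ler_wpM2r; first exact: sqb_norm_ge0.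
by rewrite le_max lexx.
Qed.

(** On [s, 2s) with s >= 1, theta is at least (2s)^(-1/p); the factor 2^(1/p) goes into the
    constant. *)
Lemma bounded_Theta_lower_boyd p q : 0 < p ->
  bounded_into_E2 E (Theta p q) -> (p%:E <= lower_boyd E)%E.
Proof.
move=> p0 /bounded_Theta_dilation_norm[C C0 hC].
apply: (lower_boyd_ge (C := C * 2 `^ p^-1)) => //.
  by rewrite mulr_gt0// powR_gt0.
move=> s s1; have s0 : 0 < s by exact: lt_le_trans s1.
have c0 : 0 < (2 * s) `^ (- p^-1) by rewrite powR_gt0// mulr_gt0.
apply: (le_trans (hC s _ `[s, 2 * s[%classic s0 c0 _ _ _ _)) => //.
- move=> t; rewrite /Rplus/= !in_itv/= andbT => /andP[st _].
  by apply: le_trans st; exact: ltW.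
- rewrite lebesgue_measure_itv/= lte_fin ifT; last by lra.
  by rewrite -EFinD; congr (_%:E); lra.
- move=> t; rewrite /= in_itv/= => /andP[st ts].
  have t1 := le_trans s1 st.
  rewrite theta_ge1//; apply: powR_le_inv => //; last exact: ltW.
  exact: lt_le_trans t1.
by rewrite powRN invrK powRM ?(ltW s0)// mulrA.
Qed.

(** On (0, s) with s <= 1, theta is at least s^(-1/q). *)
Lemma bounded_Theta_upper_boyd p q : 0 < q ->
  bounded_into_E2 E (Theta p q) -> (upper_boyd E <= q%:E)%E.
Proof.
move=> q0 /bounded_Theta_dilation_norm[C C0 hC].
apply: (upper_boyd_le (C := C)) => //.
move=> s s0 s1; have c0 : 0 < s `^ (- q^-1) by rewrite powR_gt0.
apply: (le_trans (hC s _ `]0, s[%classic s0 c0 _ _ _ _)) => //.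
- by move=> t; rewrite /Rplus/= !in_itv/= andbT => /andP[/ltW].
- by rewrite lebesgue_measure_itv/= lte_fin s0 sube0.
- move=> t; rewrite /= in_itv/= => /andP[t0 ts].
  rewrite theta_lt1//; last exact: lt_le_trans s1.
  by apply: powR_le_inv => //; exact: ltW.
by rewrite powRN invrK.
Qed.

Lemma near_pinfty_powR_le (d e : R) : d < 0 -> 0 < e ->
  \forall s \near +oo%R, s `^ d <= e.
Proof.
move=> d0 e0; near=> s.
have s0 : 0 < s by near: s; exact: nbhs_pinfty_gt.
have h : expR (ln e / d) < s.
  by near: s; apply: nbhs_pinfty_gt; exact: num_real.
rewrite powR_expR// -[leRHS](lnK e0) ler_expR.
move: h; rewrite -[X in _ < X](lnK s0) ltr_expR ltr_ndivrMr// => h.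
by rewrite mulrC ltW.
Unshelve. all: by end_near. Qed.

Lemma near_0_powR_le (d e : R) : 0 < d -> 0 < e ->
  \forall s \near 0^'+, s `^ d <= e.
Proof.
move=> d0 e0; near=> s.
have s0 : 0 < s by [].
have h : s < expR (ln e / d).
  by near: s; apply: nbhs_right_lt; exact: expR_gt0.
rewrite powR_expR// -[leRHS](lnK e0) ler_expR.
move: h; rewrite -[X in X < _](lnK s0) ltr_expR ltr_pdivlMr// => h.
by rewrite mulrC ltW.
Unshelve. all: by end_near. Qed.

Variable K : R.
Hypothesis K1 : 1 <= K.
Hypothesis normD : forall f g, car f -> car g ->
  nrm (f \+ g) <= K * (nrm f + nrm g).

Let tensor_bounded (th : R -> R) := exists2 C, 0 <= C & forall f, car f ->
  exists g, [/\ car g, nrm g <= C * nrm f &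
    forall v, 0 < v ->
      (dist2 (fun st => (f st.1 * th st.2)%R) v <= 2^-1%:E * dist g v)%E].

(** Apply [tensor_bound] with a = 1/s, rho = s^k, c = s^(-k/p) for large s. Then a rho = s^(k-1) is
    small if k < 1, and c N(a) <= s^(1/r - k/p) is small if k > p/r; such k exist because p < r. *)
Lemma theta_tail_bounded p : 0 < p -> (p%:E < lower_boyd E)%E ->
  tensor_bounded (fun t => t `^ (- p^-1) * \1_(`[1, +oo[%classic) t).
Proof.
move=> p0 /(lt_lower_boyd p0)[r pr hr].
have k1 := K1; have r0 := lt_trans p0 pr.
pose k := (p / r + 1) / 2.
have pr1 : p / r < 1 by rewrite ltr_pdivrMr// mul1r.
have [kp kl1] : p / r < k /\ k < 1 by rewrite /k; split; lra.
have kp' : r^-1 - k / p < 0.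
  rewrite subr_lt0 ltr_pdivlMr// mulrC.
  exact: kp.
have k0 : 0 < k by apply: lt_trans kp; rewrite divr_gt0.
suff [s [s1 hs hs1 hs2]] : exists s, [/\ 1 < s, N s^-1 <= s `^ r^-1,
    s `^ (k - 1) <= 2^-1 & s `^ (r^-1 - k / p) <= (2 * K)^-1].
  have s0 : 0 < s by exact: lt_trans s1.
  have ls := ln_gt0 s1.
  have rho1 : 0 < ln (s `^ k) by rewrite ln_powR mulr_gt0.
  have rhoX (n : nat) : (s `^ k) ^+ n = expR (n%:R * ln (s `^ k)).
    by rewrite -powR_mulrn ?powR_ge0// powR_expR ?powR_gt0.
  (* Block n starts at s^(kn), where t^(-1/p) equals c^n, so b = 1; its length is below its right
     endpoint l rho^n with l = s^k. *)
  apply: (tensor_bound (I := fun n => `[(s `^ k) ^+ n, (s `^ k) ^+ n.+1[%classic)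
    (a := s^-1) (c := s `^ (- (k / p))) (rho := s `^ k) (l := s `^ k) (b := 1)
    K1 normD); rewrite ?invr_gt0 ?powR_gt0//.
  - rewrite mulrC -ler_pdivlMr; last by lra.
    rewrite mul1r; apply: le_trans hs2.
    apply: (@le_trans _ _ (s `^ (- (k / p)) * s `^ r^-1)).
      by apply: ler_wpM2l => //; exact: powR_ge0.
    rewrite -powRD; last by rewrite (gt_eqF s0) implybT.
    by rewrite addrC.
  - apply: le_trans hs1; rewrite -{1}(powRr1 (ltW s0)) -powRN -powRD.
      by rewrite addrC.
    by rewrite (gt_eqF s0) implybT.
  - exact: measurable_theta_part.
  - move=> n; rewrite lebesgue_measure_itv/= lte_fin; case: ifPn => h.
      rewrite -EFinD lee_fin exprS lerBlDr lerDl.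
      by rewrite exprn_ge0// powR_ge0.
    by rewrite lee_fin -exprS exprn_ge0// powR_ge0.
  - move=> n t; rewrite /= in_itv/= => /andP[nt tn].
    have e0 : 0 < (s `^ k) ^+ n by rewrite exprn_gt0// powR_gt0.
    rewrite ger0_norm; last by rewrite mulr_ge0 ?powR_ge0// indicE.
    apply: (@le_trans _ _ (t `^ (- p^-1))).
      by rewrite ler_piMr ?powR_ge0// indicE; case: (_ \in _).
    rewrite mul1r; apply: (le_trans (powR_le_inv e0 nt p0)).
    rewrite rhoX ln_powR powR_expR ?expR_gt0// expRK -powR_mulrn ?powR_ge0//.
    rewrite (powR_expR _ (powR_gt0 _ s0)) ln_powR ler_expR.
    by rewrite [leLHS](_ : _ = n%:R * (- (k / p) * ln s))//; ring.
  - move=> t tR; rewrite indic_tail; case: (leP 1 t) => t1;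
      last by rewrite mulr0 eqxx.
    move=> _; have t0 : 0 < t by exact: lt_le_trans t1.
    have /truncn_itv : 0 <= ln t / ln (s `^ k).
      by apply: divr_ge0; [exact: ln_ge0|exact: ltW].
    set n := Num.truncn _ => /andP[n1 n2].
    exists n; rewrite /= in_itv/= !rhoX -(lnK t0) ler_expR ltr_expR.
    by rewrite -ler_pdivlMr// n1 -ltr_pdivrMr.
suff : \forall s \near +oo%R, [/\ 1 < s, N s^-1 <= s `^ r^-1,
    s `^ (k - 1) <= 2^-1 & s `^ (r^-1 - k / p) <= (2 * K)^-1].
  by move=> /filter_ex.
near=> s; split; near: s.
- exact: nbhs_pinfty_gt.
- exact: hr.
- by apply: near_pinfty_powR_le; [lra|rewrite invr_gt0].
- by apply: near_pinfty_powR_le => //; rewrite invr_gt0; lra.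
Unshelve. all: by end_near. Qed.

(** The same scheme with s near 0: the blocks shrink to 0, and the two exponents k - 1 and 1/r - k/q
    must be positive, so k is taken between 1 and q/r. *)
Lemma theta_head_bounded q : 0 < q -> (upper_boyd E < q%:E)%E ->
  tensor_bounded (fun t => t `^ (- q^-1) * \1_(`]0, 1[%classic) t).
Proof.
move=> q0 /(upper_boyd_lt q0)[r /andP[r0 rq] hr].
have k1 := K1.
pose k := (q / r + 1) / 2.
have qr1 : 1 < q / r by rewrite ltr_pdivlMr// mul1r.
have [kq kl1] : k < q / r /\ 1 < k by rewrite /k; split; lra.
have kq' : 0 < r^-1 - k / q.
  rewrite subr_gt0 ltr_pdivrMr// mulrC.
  exact: kq.
have k0 : 0 < k by exact: lt_trans kl1.
suff [s [/andP[s0 s1] hs hs1 hs2]] : exists s, [/\ 0 < s < 1, N s^-1 <= s `^ r^-1,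
    s `^ (k - 1) <= 2^-1 & s `^ (r^-1 - k / q) <= (2 * K)^-1].
  have ls : ln s < 0 by rewrite ln_lt0// s0.
  have rho1 : ln (s `^ k) < 0 by rewrite ln_powR pmulr_rlt0.
  have rhoX (n : nat) : (s `^ k) ^+ n = expR (n%:R * ln (s `^ k)).
    by rewrite -powR_mulrn ?powR_ge0// powR_expR ?powR_gt0.
  (* On block n, t^(-1/q) is bounded by its value c^(n+1) at the left endpoint; the extra factor c
     is the choice of b. *)
  apply: (tensor_bound (I := fun n => `](s `^ k) ^+ n.+1, (s `^ k) ^+ n]%classic)
    (a := s^-1) (c := s `^ (- (k / q))) (rho := s `^ k) (l := 1)
    (b := s `^ (- (k / q))) K1 normD); rewrite ?invr_gt0 ?powR_gt0//.
  - rewrite mulrC -ler_pdivlMr; last by lra.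
    rewrite mul1r; apply: le_trans hs2.
    apply: (@le_trans _ _ (s `^ (- (k / q)) * s `^ r^-1)).
      by apply: ler_wpM2l => //; exact: powR_ge0.
    rewrite -powRD; last by rewrite (gt_eqF s0) implybT.
    by rewrite addrC.
  - apply: le_trans hs1; rewrite -{1}(powRr1 (ltW s0)) -powRN -powRD.
      by rewrite addrC.
    by rewrite (gt_eqF s0) implybT.
  - exact: measurable_theta_part.
  - move=> n; rewrite lebesgue_measure_itv/= lte_fin mul1r; case: ifPn => h.
      by rewrite -EFinD lee_fin lerBlDr lerDl exprn_ge0// powR_ge0.
    by rewrite lee_fin exprn_ge0// powR_ge0.
  - move=> n t; rewrite /= in_itv/= => /andP[nt tn].
    have e0 : 0 < (s `^ k) ^+ n.+1 by rewrite exprn_gt0// powR_gt0.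
    rewrite ger0_norm; last by rewrite mulr_ge0 ?powR_ge0// indicE.
    apply: (@le_trans _ _ (t `^ (- q^-1))).
      by rewrite ler_piMr ?powR_ge0// indicE; case: (_ \in _).
    apply: (le_trans (powR_le_inv e0 (ltW nt) q0)).
    rewrite -exprS rhoX ln_powR powR_expR ?expR_gt0// expRK.
    rewrite -powR_mulrn ?powR_ge0//.
    rewrite (powR_expR _ (powR_gt0 _ s0)) ln_powR ler_expR.
    by rewrite [leLHS](_ : _ = n.+1%:R * (- (k / q) * ln s))//; ring.
  - move=> t tR; rewrite indic_head; have [/andP[t0 t1] _|] := boolP (0 < t < 1);
      last by rewrite mulr0 eqxx.
    (* Dividing by the negative ln (s^k) reverses the order, which is why these blocks are open on
       the left and closed on the right. *)
    have /truncn_itv : 0 <= ln t / ln (s `^ k).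
      by rewrite -mulrNN -invrN divr_ge0// oppr_ge0 ltW// ln_lt0// t0.
    set n := Num.truncn _ => /andP[n1 n2].
    exists n; rewrite /= in_itv/= !rhoX -(lnK t0) ler_expR ltr_expR.
    by rewrite -ltr_ndivrMr// n2 -ler_ndivlMr.
suff : \forall s \near 0^'+, [/\ 0 < s < 1, N s^-1 <= s `^ r^-1,
    s `^ (k - 1) <= 2^-1 & s `^ (r^-1 - k / q) <= (2 * K)^-1].
  by move=> /filter_ex.
near=> s; have s1 : s < 1 by near: s; exact: nbhs_right_lt.
split; [exact/andP| | |]; near: s.
- exact: hr.
- by apply: near_0_powR_le; [lra|rewrite invr_gt0].
- by apply: near_0_powR_le => //; rewrite invr_gt0; lra.
Unshelve. all: by end_near. Qed.

(** Head and tail are each controlled by half the distribution function of some g1, g2 in E; with g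
    = |g1| + |g2| the two halves add up to at most d(v; g). *)
Lemma Theta_bounded p q : 0 < p -> 0 < q ->
  (p%:E < lower_boyd E)%E -> (upper_boyd E < q%:E)%E ->
  bounded_into_E2 E (Theta p q).
Proof.
move=> p0 q0 /(theta_tail_bounded p0)[C1 C10 h1].
move=> /(theta_head_bounded q0)[C2 C20 h2].
have mR2 : measurable (Rplus2 : set (R * R)) by exact: measurableX.
suff main f : car f -> [/\ S2 (Theta p q f),
    car (fun t => fine (mu2 (Theta p q f) t)) &
    nrm (fun t => fine (mu2 (Theta p q f) t)) <= K * (C1 + C2) * nrm f].
  split=> [f /main[]//|].
  by exists (K * (C1 + C2)) => f /main[].
move=> Ef; have [g1 [E1 n1 d1]] := h1 f Ef; have [g2 [E2 n2 d2]] := h2 f Ef.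
have mf := sqb_measurable Ef.
have abs g : car g -> car (fun x => `|g x|) /\ nrm (fun x => `|g x|) <= nrm g.
  move=> Eg; apply: sqb_dom => //; last by move=> x _; rewrite normr_id.
  by apply: measurableT_comp => //; exact: sqb_measurable Eg.
have [A1 a1] := abs _ E1; have [A2 a2] := abs _ E2.
pose g := (fun x => `|g1 x|) \+ (fun x => `|g2 x|).
have Eg : car g by exact: sqb_add.
have ng : nrm g <= K * (C1 + C2) * nrm f.
  apply: (le_trans (normD A1 A2)); rewrite -mulrA ler_wpM2l//.
    by have := K1; lra.
  by rewrite mulrDl; apply: lerD; [exact: le_trans n1|exact: le_trans n2].
suff hd v : 0 < v -> (dist2 (Theta p q f) v <= dist g v)%E.
  have tr := sqb_rearrangement _ _ Eg hd.
  have [S c n] := tr mR2 (measurable_Theta p q mf).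
  by split => //; exact: le_trans ng.
move=> v0.
have half (x : \bar R) : (0 <= x -> 2^-1%:E * x + 2^-1%:E * x = x)%E.
  move=> x0; rewrite -ge0_muleDl ?lee_fin//.
  by rewrite -EFinD (_ : 2^-1 + 2^-1 = 1 :> R) ?mul1e//; lra.
have mg := sqb_measurable Eg.
have le1 : (dist g1 v <= dist g v)%E.
  apply: distribution_function_dom => //; [exact: sqb_measurable E1|].
  by move=> x _; rewrite /g/= [leRHS]ger0_norm ?addr_ge0// lerDl.
have le2 : (dist g2 v <= dist g v)%E.
  apply: distribution_function_dom => //; first exact: sqb_measurable E2.
  by move=> x _; rewrite /g/= [leRHS]ger0_norm ?addr_ge0// lerDr.
rewrite -(half (dist g v)) ?distribution_function_ge0//.
pose T1 (st : R * R) := f st.1 * (st.2 `^ (- p^-1) * \1_(`[1, +oo[%classic) st.2).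
pose T2 (st : R * R) := f st.1 * (st.2 `^ (- q^-1) * \1_(`]0, 1[%classic) st.2).
have mT1 : measurable_fun Rplus2 T1.
  exact: measurable_tensor mf (measurable_theta_part _ (measurable_itv _)).
have mT2 : measurable_fun Rplus2 T2.
  exact: measurable_tensor mf (measurable_theta_part _ (measurable_itv _)).
apply: (@le_trans _ _ (dist2 T1 v + dist2 T2 v)%E); last first.
  apply: leeD.
    apply: (le_trans (d1 _ v0)); apply: lee_wpmul2l => //.
  apply: (le_trans (d2 _ v0)); apply: lee_wpmul2l => //.
have mS1 := measurable_superlevel mR2 v mT1.
have mS2 := measurable_superlevel mR2 v mT2.
(* Head and tail live on t < 1 and t >= 1, so the superlevel set is covered by theirs at the same
   level v. *)
apply: (@le_trans _ _ (lebesgue2 ((Rplus2 `&` [set st | (v < `|T1 st|)%R]) `|`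
    (Rplus2 `&` [set st | (v < `|T2 st|)%R])))).
  2: by rewrite /distribution_function /lebesgue2; exact: measureU2.
apply: le_measure; rewrite ?inE.
- by apply: measurable_superlevel => //; exact: measurable_Theta.
- exact: measurableU.
move=> [s t] [/= st]; rewrite /Theta/= /theta.
rewrite indic_head indic_tail.
have [t1|t1] := leP 1 t.
  rewrite andbF mulr0 add0r => vf; left; split => //=.
  by rewrite /T1/= indic_tail t1.
rewrite andbT [X in _ + X]mulr0 addr0 => vf; right; split => //=.
by rewrite /T2/= indic_head t1 andbT.
Qed.

End Theta.

Theorem corollary3p3 (R : realType) (p q : R) (E : symmetric_quasi_Banach R)
    (p_gt0 : 0 < p) (ltpq : p < q) :
  ([/\ (p%:E < lower_boyd E)%E,
       (lower_boyd E <= upper_boyd E)%E &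
       (upper_boyd E < q%:E)%E] ->
   bounded_into_E2 E (Theta p q))
  /\
  (bounded_into_E2 E (Theta p q) ->
   [/\ (p%:E <= lower_boyd E)%E,
       (lower_boyd E <= upper_boyd E)%E &
       (upper_boyd E <= q%:E)%E]).
Proof.
have q_gt0 := lt_trans p_gt0 ltpq.
split=> [[lo _ up]|b].
  by have [K K1 hK] := sqb_quasi E; exact: (Theta_bounded K1 hK).
split; first exact: bounded_Theta_lower_boyd b.
  exact: lower_boyd_le_upper.
exact: bounded_Theta_upper_boyd b.
Qed.
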